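(* For $X\sim N(\theta^*,\sigma^2I_n)$ and every $k\in[n]$, $$\inf_{\widehat{\theta}}\sup_{\theta^*\in\Theta_{k}}\mathbb{E}\|\widehat{\theta}-\theta^*\|^2\asymp\begin{cases} \sigma^2, & k=1, \\ \sigma^2\log\log(16n), & k=2, \\ \sigma^2k\log(en/k), & k\geq 3, \end{cases}$$ where $\asymp$ means that the left side is bounded above and below by the right side up to universal positive constant factors (independent of $n,k,\sigma$), and the infimum is over all measurable functions of $X$.
   Context: $[n]=\{1,\dots,n\}$. For reals $a\le b$, $(a:b]$ is the set of integers $i$ with $a<i\le b$. For $k\in[n]$, $\Theta_k$ is the set of $\theta\in\mathbb{R}^n$ for which there exist integers $0=a_0\le a_1\le\cdots\le a_k=n$ and reals $\mu_1,\dots,\mu_k$ (no ordering constraint) with $\theta_i=\mu_j$ for all $i\in(a_{j-1}:a_j]$. *)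

(* Defs.v *)
From HB Require Import structures.
From mathcomp Require Import all_boot all_order all_algebra.
From mathcomp Require Import all_classical all_reals all_analysis.
Set Implicit Arguments. Unset Strict Implicit. Unset Printing Implicit Defensive.
Import Order.TTheory GRing.Theory Num.Theory.
Local Open Scope classical_set_scope.
Local Open Scope ring_scope.

Section gaussian_model.
Variable R : realType.

(* Expectation of a (nonnegative) function [f] of X ~ N(theta, sigma^2 I_n),
   where X is an n-tuple of reals.  Since N(theta, sigma^2 I_n) is the product
   of the one-dimensional laws N(theta_i, sigma^2) ([normal_prob] takes the
   standard deviation), the expectation is computed as the iterated integral
   against these one-dimensional laws (equal to the integral against the
   product measure for measurable nonnegative f, by Tonelli). *)
Fixpoint gauss_expect (sigma : R) (n : nat) :
    n.-tuple R -> (n.-tuple R -> \bar R) -> \bar R :=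
  match n with
  | 0 => fun _ f => f [tuple]
  | m.+1 => fun theta f =>
      (\int[normal_prob (thead theta) sigma]_x
         gauss_expect sigma (behead_tuple theta) (fun y => f (cons_tuple x y)))%E
  end.

Definition sqdist (n : nat) (u v : n.-tuple R) : R :=
  \sum_(i < n) (tnth u i - tnth v i) ^+ 2.

(* Theta_k : piecewise constant vectors with (at most) k pieces.
   Coordinate i \in [n] of the paper is [tnth theta i'] with i = i'.+1. *)
Definition Theta (n k : nat) : set (n.-tuple R) :=
  [set theta | exists (a : nat -> nat) (mu : nat -> R),
     [/\ a 0 = 0%N, a k = n,
         (forall j, (j < k)%N -> (a j <= a j.+1)%N) &
         (forall (i : 'I_n) (j : nat), (1 <= j <= k)%N ->
            (a j.-1 < i.+1 <= a j)%N -> tnth theta i = mu j)]].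

Definition risk (sigma : R) (n : nat) (est : n.-tuple R -> n.-tuple R)
    (theta : n.-tuple R) : \bar R :=
  gauss_expect sigma theta (fun x => (sqdist (est x) theta)%:E).

Definition minimax_risk (sigma : R) (n k : nat) : \bar R :=
  ereal_inf [set ereal_sup [set risk sigma est theta | theta in @Theta n k]
            | est in [set est : n.-tuple R -> n.-tuple R |
                      measurable_fun setT est]].

Definition rate (sigma : R) (n k : nat) : R :=
  if k == 1%N then sigma ^+ 2
  else if k == 2%N then sigma ^+ 2 * ln (ln (16 * n%:R))
  else sigma ^+ 2 * k%:R * ln (expR 1 * n%:R / k%:R).

End gaussian_model.

(* Main.v *)
Require Import Defs.
From HB Require Import structures.
From mathcomp Require Import all_boot all_order all_algebra.
From mathcomp Require Import all_classical all_reals all_analysis.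
From mathcomp Require Import measurable_realfun ring lra zify.
Set Implicit Arguments. Unset Strict Implicit. Unset Printing Implicit Defensive.
Import Order.TTheory GRing.Theory Num.Theory.
Local Open Scope classical_set_scope.
Local Open Scope ring_scope.

(** Lower bounds.  Let theta_1, ..., theta_N have squared norm at most
    sigma^2 log(N) / 2 and pairwise squared distance at least 4 d.  Relative to
    N(0, sigma^2 I) the likelihoods have mean 1 and second moment at most sqrt N,
    so the largest of them has mean at most N^(3/4), and on average every
    estimator pays d for most of the theta_j.  For k = 1 two opposite constant vectors suffice, for k = 2 take
    steps of length 4^j and equal norm (N ~ log n), and for k >= 3 a Gilbert
    packing of the vectors with one spike in each of about k / 2 segments
    (log N ~ k log(n / k)).

    Upper bounds.  The least squares estimator over a family of partitions
    satisfies |est - theta|^2 <= 4 |P noise|^2, where P projects onto the vectors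
    that are constant on the common refinement of the selected and the true partition;
    |P noise|^2 is a sum of normalised squared block sums with bounded
    exponential moments.  For k >= 3 (and k = 1) a union bound over the
    partitions gives k log(en / k).  For k = 2 every block has one endpoint
    fixed in advance, and dyadic chaining bounds the maximum over the other
    endpoint by log log n. *)

(** * One-dimensional Gaussian integrals *)

Section normal.
Variable R : realType.
Local Notation mu := (@lebesgue_measure R).

(** The Radon-Nikodym derivative and the density agree almost everywhere, because they have the same
    integral over every measurable set. *)
Lemma integral_normal_probE (m s : R) (f : R -> \bar R) :
  measurable_fun setT f -> (forall x, (0 <= f x)%E) ->
  (\int[normal_prob m s]_x f x = \int[mu]_x (f x * (normal_pdf m s x)%:E))%E.
Proof.
move=> mf f0; have dom := normal_prob_dominates m s.
rewrite -(Radon_Nikodym_SigmaFinite.change_of_variables dom)//.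
have ig := Radon_Nikodym_SigmaFinite.f_integrable dom.
have mpdf : measurable_fun setT (fun x : R => (normal_pdf m s x)%:E).
  by apply/measurable_EFinP; exact: measurable_normal_pdf.
apply: ae_eq_integral => //.
- by apply: emeasurable_funM => //; exact: measurable_int ig.
- exact: emeasurable_funM.
- apply: ae_eqe_mul2l; apply: integral_ae_eq => //= E _ mE.
  by rewrite -Radon_Nikodym_SigmaFinite.f_integral.
Qed.

Lemma normal_prob_tilt (m s : R) (f : R -> \bar R) : 0 < s ->
  measurable_fun setT f -> (forall x, (0 <= f x)%E) ->
  (\int[normal_prob m s]_x f x =
   \int[normal_prob 0 s]_x ((expR ((m * x - m ^+ 2 / 2) / s ^+ 2))%:E * f x))%E.
Proof.
move=> s0 mf f0; rewrite !integral_normal_probE//; last first.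
- by move=> x; rewrite mule_ge0// lee_fin expR_ge0.
- apply: emeasurable_funM => //; apply/measurable_EFinP.
  apply: measurableT_comp => //; apply: measurable_funM => //.
  by apply: measurable_funB => //; exact: measurable_funM.
apply: eq_integral => x _; rewrite (muleC _ (f x)) -muleA; congr (_ * _)%E.
rewrite -EFinM; congr EFin; rewrite !normal_pdfE ?gt_eqF//.
rewrite mulrCA -expRD /normal_fun; congr (_ * expR _); field.
by rewrite gt_eqF.
Qed.

(** Completing the square: the integrand times the density is a multiple of another normal density,
    with mean [m'] and standard deviation [s / sqrt D]. The offset [t] serves the induction over
    coordinates in [gauss_expect_exp_sq]. *)
Lemma normal_prob_exp_sq (m s a t c : R) : 0 < s -> 0 < 1 - 2 * a * c ^+ 2 ->
  (\int[normal_prob m s]_x (expR (a * (t + c * ((x - m) / s)) ^+ 2))%:E =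
   ((Num.sqrt (1 - 2 * a * c ^+ 2))^-1 *
     expR (a * t ^+ 2 / (1 - 2 * a * c ^+ 2)))%:E)%E.
Proof.
move=> s0; have [D DE] : {D | D = 1 - 2 * a * c ^+ 2} by eexists.
rewrite -DE => D0.
have rD0 : 0 < Num.sqrt D by rewrite sqrtr_gt0.
have rDE : Num.sqrt D ^+ 2 = D by rewrite sqr_sqrtr// ltW.
rewrite integral_normal_probE; last first.
- by move=> x; rewrite lee_fin expR_ge0.
- apply/measurable_EFinP/measurableT_comp => //; apply: measurable_funM => //.
  apply: measurable_funX; apply: measurable_funD => //.
  apply: measurable_funM => //; apply: measurable_funM => //.
  exact: measurable_funB.
have s'0 : 0 < s / Num.sqrt D by rewrite divr_gt0.
have [m' m'E] : {m' | m' = m + s * (2 * a * c * t / D)} by eexists.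
transitivity (\int[mu]_x (((Num.sqrt D)^-1 * expR (a * t ^+ 2 / D))%:E *
   (normal_pdf m' (s / Num.sqrt D) x)%:E))%E.
  apply: eq_integral => x _; rewrite -!EFinM; congr EFin.
  rewrite !normal_pdfE ?gt_eqF//.
  have -> : normal_peak s = (Num.sqrt D)^-1 * normal_peak (s / Num.sqrt D).
    rewrite /normal_peak -invfM; congr (_^-1).
    rewrite -sqrtrM ?(ltW D0)//; congr Num.sqrt.
    rewrite expr_div_n rDE.
    by field; rewrite gt_eqF.
  have key : expR (a * (t + c * ((x - m) / s)) ^+ 2) * normal_fun m s x =
      expR (a * t ^+ 2 / D) * normal_fun m' (s / Num.sqrt D) x.
    rewrite -!expRD; congr expR; rewrite m'E expr_div_n rDE.
    have -> : a * t ^+ 2 / D = a * t ^+ 2 + 2 * a ^+ 2 * c ^+ 2 * t ^+ 2 / D.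
      by rewrite -[X in X + _](mulfK (lt0r_neq0 D0)) -mulrDl; congr (_ / D); rewrite DE; ring.
    have -> : a * (t + c * ((x - m) / s)) ^+ 2 = a * t ^+ 2 +
       2 * a * c * t * ((x - m) / s) + ((1 - D) / 2) * ((x - m) / s) ^+ 2.
      by rewrite DE; field; rewrite gt_eqF.
    by field; rewrite !gt_eqF.
  rewrite mulrCA key -!mulrA; congr (_ * _); exact: mulrCA.
rewrite ge0_integralZl.
- by rewrite integral_normal_pdf mule1.
- by [].
- by apply/measurable_EFinP; exact: measurable_normal_pdf.
- by move=> x _; rewrite lee_fin normal_pdf_ge0.
- by rewrite lee_fin mulr_ge0 ?expR_ge0// invr_ge0 ltW.
Qed.

End normal.

(** * Iterated Gaussian expectation *)

Section gauss_expect_theory.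
Variables (R : realType) (sigma : R).
Local Notation E := (@gauss_expect R sigma _).

Lemma measurable_cons_tuple d (T : measurableType d) n (g : T -> R)
    (h : T -> n.-tuple R) : measurable_fun setT g -> measurable_fun setT h ->
  measurable_fun setT (fun t => cons_tuple (g t) (h t)).
Proof.
move=> mg mh; have := measurable_cons mg mh.
by congr (measurable_fun _ _); apply/funext => t; exact: val_inj.
Qed.

Lemma gauss_expect_ge0 n (theta : n.-tuple R) f :
  (forall y, 0 <= f y)%E -> (0 <= E theta f)%E.
Proof.
elim: n theta f => [|n IH] theta f f0 //=.
by apply: integral_ge0 => x _; exact: IH.
Qed.

(** Induction on [n] through Fubini-Tonelli; the parameter space [T] is arbitrary so that the first
    coordinate can join it, as [T * R], in the induction step. *)
Lemma measurable_gauss_expect n (theta : n.-tuple R) d (T : measurableType d)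
    (f : T * n.-tuple R -> \bar R) :
  measurable_fun setT f -> (forall p, 0 <= f p)%E ->
  measurable_fun setT (fun t => E theta (fun y => f (t, y))).
Proof.
elim: n theta d T f => [|n IH] theta d T f mf f0 /=.
  exact: (measurableT_comp mf (measurable_fun_pair _ _)).
pose h (p : (T * R) * n.-tuple R) := f (p.1.1, cons_tuple p.1.2 p.2).
have mh : measurable_fun setT h.
  apply: (measurableT_comp mf); apply: measurable_fun_pair => /=.
    exact: measurableT_comp.
  by apply: measurable_cons_tuple => //; exact: measurableT_comp.
have := IH (behead_tuple theta) _ _ h mh (fun p => f0 _).
move=> /(measurable_fun_fubini_tonelli_F
  (m2 := normal_prob (thead theta) sigma)); apply => p.
by apply: gauss_expect_ge0 => y; exact: f0.
Qed.

Lemma measurable_gauss_expect_cons n (theta : n.-tuple R)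
    (f : n.+1.-tuple R -> \bar R) :
  measurable_fun setT f -> (forall p, 0 <= f p)%E ->
  measurable_fun setT (fun x => E theta (fun y => f (cons_tuple x y))).
Proof.
move=> mf f0.
apply: (@measurable_gauss_expect _ theta _ _ (fun p => f (cons_tuple p.1 p.2))) => //.
by apply: (measurableT_comp mf); exact: measurable_cons_tuple.
Qed.

Lemma measurable_section n (f : n.+1.-tuple R -> \bar R) x :
  measurable_fun setT f -> measurable_fun setT (fun y => f (cons_tuple x y)).
Proof. by move=> mf; apply: (measurableT_comp mf); exact: measurable_cons_tuple. Qed.

Lemma gauss_expect_le n (theta : n.-tuple R) f g :
  measurable_fun setT f -> measurable_fun setT g ->
  (forall y, 0 <= f y)%E -> (forall y, f y <= g y)%E ->
  (E theta f <= E theta g)%E.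
Proof.
elim: n theta f g => [|n IH] theta f g mf mg f0 fg //=.
apply: ge0_le_integral => //.
- by move=> x _; exact: gauss_expect_ge0.
- exact: measurable_gauss_expect_cons.
- by apply: measurable_gauss_expect_cons => // y; exact: le_trans (fg y).
- by move=> x _; apply: IH => //; exact: measurable_section.
Qed.

Lemma gauss_expectD n (theta : n.-tuple R) f g :
  measurable_fun setT f -> measurable_fun setT g ->
  (forall y, 0 <= f y)%E -> (forall y, 0 <= g y)%E ->
  E theta (fun y => f y + g y)%E = (E theta f + E theta g)%E.
Proof.
elim: n theta f g => [|n IH] theta f g mf mg f0 g0 //=.
rewrite -ge0_integralD//.
- by apply: eq_integral => x _; apply: IH => //; exact: measurable_section.
- by move=> x _; exact: gauss_expect_ge0.
- exact: measurable_gauss_expect_cons.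
- by move=> x _; exact: gauss_expect_ge0.
- exact: measurable_gauss_expect_cons.
Qed.

Lemma gauss_expectZ n (theta : n.-tuple R) f (k : R) :
  measurable_fun setT f -> (forall y, 0 <= f y)%E -> 0 <= k ->
  E theta (fun y => k%:E * f y)%E = (k%:E * E theta f)%E.
Proof.
elim: n theta f => [|n IH] theta f mf f0 k0 //=.
rewrite -ge0_integralZl_EFin//.
- by apply: eq_integral => x _; apply: IH => //; exact: measurable_section.
- by move=> x _; exact: gauss_expect_ge0.
- exact: measurable_gauss_expect_cons.
Qed.

Lemma gauss_expect_cst n (theta : n.-tuple R) (k : R) :
  E theta (cst k%:E) = k%:E.
Proof.
elim: n theta => [|n IH] theta //=.
under eq_integral do rewrite IH.
by rewrite integral_cst//= probability_setT mule1.
Qed.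

Lemma gauss_expect_sum n (theta : n.-tuple R) (I : Type) (s : seq I)
    (f : I -> n.-tuple R -> \bar R) :
  (forall i, measurable_fun setT (f i)) -> (forall i y, 0 <= f i y)%E ->
  E theta (fun y => \sum_(i <- s) f i y)%E = (\sum_(i <- s) E theta (f i))%E.
Proof.
move=> mf f0; elim: s => [|i s IH].
  by rewrite big_nil -[RHS](gauss_expect_cst theta 0); congr gauss_expect;
    apply/funext => y; rewrite big_nil.
rewrite big_cons -IH -gauss_expectD//.
- by congr gauss_expect; apply/funext => y; rewrite big_cons.
- exact: emeasurable_sum.
- by move=> y; apply: sume_ge0.
Qed.

End gauss_expect_theory.

Lemma tnth_consS (T : Type) n (x : T) (y : n.-tuple T) i :
  tnth (cons_tuple x y) (lift ord0 i) = tnth y i.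
Proof. by rewrite !(tnth_nth x). Qed.

Lemma tnth_beheadS (T : Type) n (t : n.+1.-tuple T) i :
  tnth (behead_tuple t) i = tnth t (lift ord0 i).
Proof. by rewrite !(tnth_nth (thead t)) /= nth_behead. Qed.

Lemma big_ord_recl_cond (V : nmodType) n (P : pred 'I_n.+1) (F : 'I_n.+1 -> V) :
  \sum_(i | P i) F i = (if P ord0 then F ord0 else 0) +
     \sum_(i < n | P (lift ord0 i)) F (lift ord0 i).
Proof. by rewrite big_mkcond big_ord_recl /= -big_mkcond. Qed.

(** * Exponential moments and likelihood ratios *)

Section gauss_moments.
Variables (R : realType) (sigma : R).
Hypothesis sigma0 : 0 < sigma.
Local Notation E := (@gauss_expect R sigma _).

(** Induction on the coordinates, with the offsets [s j] collecting those already fixed. The inner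
    expectation is a product over blocks, and only the factor of the block [b ord0] depends on the
    first coordinate. *)
Lemma gauss_expect_exp_sq n (theta : n.-tuple R) (B : finType) (b : 'I_n -> B)
    (w : 'I_n -> R) (s : B -> R) (a : R) :
  let D j := 1 - 2 * a * \sum_(i | b i == j) w i ^+ 2 in
  0 <= a -> (forall j, 0 < D j) ->
  E theta (fun x => (expR (a * \sum_j (s j +
     \sum_(i | b i == j) w i * ((tnth x i - tnth theta i) / sigma)) ^+ 2))%:E) =
  (\prod_j ((Num.sqrt (D j))^-1 * expR (a * s j ^+ 2 / D j)))%:E.
Proof.
elim: n theta b w s => [|n IH] theta b w s D a0 D0 /=.
  congr EFin; rewrite mulr_sumr expR_sum; apply: eq_bigr => j _.
  by rewrite /D !big_ord0 addr0 mulr0 subr0 sqrtr1 invr1 mul1r mulr1.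
pose b' i := b (lift ord0 i); pose w' i := w (lift ord0 i).
pose D' j := 1 - 2 * a * \sum_(i | b' i == j) w' i ^+ 2.
have DD' j : D j = D' j - 2 * a * (if b ord0 == j then w ord0 ^+ 2 else 0).
  have eS : \sum_(i | b i == j) w i ^+ 2 =
      (if b ord0 == j then w ord0 ^+ 2 else 0) + \sum_(i | b' i == j) w' i ^+ 2.
    exact: (big_ord_recl_cond (fun i => b i == j)).
  by rewrite /D /D' eS; move: (if _ then _ else _) (bigop _ _ _) => u v; ring.
have D'0 j : 0 < D' j.
  apply: lt_le_trans (D0 j) _; rewrite DD' lerBlDr lerDl mulr_ge0 ?mulr_ge0//.
  by case: ifP => // _; exact: sqr_ge0.
pose s' x j := s j +
  (if b ord0 == j then w ord0 * ((x - thead theta) / sigma) else 0).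
under eq_integral => x _.
  have -> : (fun y => (expR (a * \sum_j (s j + \sum_(i | b i == j) w i *
     ((tnth (cons_tuple x y) i - tnth theta i) / sigma)) ^+ 2))%:E) =
    (fun y => (expR (a * \sum_j (s' x j + \sum_(i | b' i == j) w' i *
     ((tnth y i - tnth (behead_tuple theta) i) / sigma)) ^+ 2))%:E).
    apply/funext => y; congr (expR (_ * _))%:E; apply: eq_bigr => j _.
    rewrite (big_ord_recl_cond (fun i => b i == j)) addrA; congr ((_ + _ + _) ^+ 2).
    by apply: eq_bigr => i _; rewrite tnth_consS tnth_beheadS.
  rewrite (IH _ b' w' (s' x) a0 D'0) (bigD1 (b ord0))//=.
  rewrite (eq_bigr (fun j => (Num.sqrt (D j))^-1 * expR (a * s j ^+ 2 / D j)));
    last by move=> j /negbTE; rewrite /s' DD' eq_sym => ->; rewrite mulr0 subr0 addr0.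
  rewrite {1}/s' eqxx.
  rewrite (_ : a * _ / _ = (a / D' (b ord0)) *
    (s (b ord0) + w ord0 * ((x - thead theta) / sigma)) ^+ 2); last by rewrite mulrAC.
  rewrite mulrAC EFinM.
  over.
set Q := \prod_(j | _) _.
have Q0 : 0 <= Q.
  by apply: prodr_ge0 => j _; rewrite mulr_ge0 ?expR_ge0// invr_ge0 sqrtr_ge0.
set j0 := b ord0.
(* Integrating the first coordinate with coefficient [a / D' j0] turns [D'] into [D] in the factor
   of its block. *)
have DE : 1 - 2 * (a / D' j0) * w ord0 ^+ 2 = D j0 / D' j0.
  by rewrite DD' eqxx; field; rewrite gt_eqF.
rewrite ge0_integralZl.
- rewrite normal_prob_exp_sq//; last by rewrite DE divr_gt0.
  rewrite DE -EFinM; congr EFin; rewrite (bigD1 j0)//= -/Q.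
  rewrite sqrtrM ?(ltW (D0 _))// sqrtrV ?(ltW (D'0 _))//.
  have -> : a / D' j0 * s j0 ^+ 2 / (D j0 / D' j0) = a * s j0 ^+ 2 / D j0.
    by field; rewrite !gt_eqF.
  have r1 : Num.sqrt (D j0) != 0 by rewrite gt_eqF// sqrtr_gt0.
  have r2 : Num.sqrt (D' j0) != 0 by rewrite gt_eqF// sqrtr_gt0.
  by move: (Num.sqrt _) (Num.sqrt _) r1 r2 => u v r1 r2; field; rewrite r1 r2.
- by [].
- apply/measurable_EFinP/measurableT_comp => //; apply: measurable_funM => //.
  apply: measurable_funX; apply: measurable_funD => //.
  apply: measurable_funM => //; apply: measurable_funM => //.
  exact: measurable_funB.
- by move=> x _; rewrite lee_fin expR_ge0.
- by rewrite lee_fin mulr_ge0// invr_ge0 sqrtr_ge0.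
Qed.

Lemma gauss_expect_exp_sq_le n (theta : n.-tuple R) (B : finType) (b : 'I_n -> B)
    (w : 'I_n -> R) :
  (forall j, \sum_(i | b i == j) w i ^+ 2 <= 1) ->
  (E theta (fun x => (expR (4^-1 * \sum_j (
     \sum_(i | b i == j) w i * ((tnth x i - tnth theta i) / sigma)) ^+ 2))%:E) <=
  (2 ^+ #|B|)%:E)%E.
Proof.
move=> w1.
pose D j := 1 - 2 * 4^-1 * \sum_(i | b i == j) w i ^+ 2.
(* Even [1 / 2] is a lower bound; [1 / 4] has the square root [1 / 2], so that each block
   contributes a factor of at most 2. *)
have D4 j : 4^-1 <= D j by have := w1 j; rewrite /D; lra.
have D0 j : 0 < D j by apply: lt_le_trans (D4 j); rewrite invr_gt0.
have := @gauss_expect_exp_sq n theta B b w (fun=> 0) 4^-1 _ D0.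
under eq_fun do under eq_bigr do rewrite add0r.
move=> ->//; rewrite lee_fin -prodr_const; apply: ler_prod => j _.
rewrite expr0n mulr0 mul0r expR0 mulr1 invr_ge0 sqrtr_ge0/=.
rewrite -[leRHS]invrK lef_pV2 ?posrE ?sqrtr_gt0 ?invr_gt0//; last exact: D0.
have -> : 2^-1 = Num.sqrt (4^-1) :> R.
  by rewrite -[4^-1](_ : 2^-1 ^+ 2 = _) ?sqrtr_sqr ?ger0_norm ?invr_ge0//; field.
by apply: ler_wsqrtr; exact: D4.
Qed.

(* Density of N(theta, sigma^2 I) relative to N(0, sigma^2 I). *)
Definition likelihood n (theta x : n.-tuple R) : R :=
  expR (\sum_i (tnth theta i * tnth x i - tnth theta i ^+ 2 / 2) / sigma ^+ 2).

Lemma measurable_likelihood n (theta : n.-tuple R) :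
  measurable_fun setT (likelihood theta).
Proof.
apply: measurableT_comp => //; apply: measurable_sum => i.
apply: measurable_funM => //; apply: measurable_funB => //.
by apply: measurable_funM => //; exact: measurable_tnth.
Qed.

(** Change of measure to the common law at 0, under which the losses at different [theta] can be
    compared pointwise. *)
Lemma gauss_expect_tilt n (theta : n.-tuple R) f :
  measurable_fun setT f -> (forall x, 0 <= f x)%E ->
  E theta f = E [tuple 0 | _ < n] (fun x => (likelihood theta x)%:E * f x)%E.
Proof.
elim: n theta f => [|n IH] theta f mf f0 /=.
  by rewrite /likelihood big_ord0 expR0 mul1e.
rewrite (_ : thead [tuple 0 | _ < n.+1] = 0); last by rewrite /thead tnth_mktuple.
rewrite (_ : behead_tuple [tuple 0 | _ < n.+1] = [tuple 0 | _ < n]); last first.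
  by apply: eq_from_tnth => i; rewrite tnth_beheadS !tnth_mktuple.
rewrite normal_prob_tilt//; first last.
- by move=> x; exact: gauss_expect_ge0.
- exact: measurable_gauss_expect_cons.
apply: eq_integral => x _.
rewrite IH//; last exact: measurable_section.
rewrite -gauss_expectZ ?expR_ge0//; last first.
- by move=> y; rewrite mule_ge0// lee_fin expR_ge0.
- apply: emeasurable_funM; last exact: measurable_section.
  by apply/measurable_EFinP; exact: measurable_likelihood.
congr gauss_expect; apply/funext => y; rewrite muleA -EFinM -expRD.
congr ((expR _)%:E * _)%E; rewrite big_ord_recl; congr (_ + _).
by apply: eq_bigr => i _; rewrite tnth_consS tnth_beheadS.
Qed.

Lemma gauss_expect_likelihood n (theta : n.-tuple R) :
  E [tuple 0 | _ < n] (fun x => (likelihood theta x)%:E) = 1%E.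
Proof.
rewrite -(gauss_expect_cst sigma theta 1) [RHS]gauss_expect_tilt//.
by congr gauss_expect; apply/funext => x; rewrite mule1.
Qed.

(** The squared likelihood at [theta] is the right side times the likelihood at [2 theta], which has
    mean 1. *)
Lemma gauss_expect_likelihood2 n (theta : n.-tuple R) :
  E [tuple 0 | _ < n] (fun x => (likelihood theta x ^+ 2)%:E) =
  (expR (sqdist theta [tuple 0 | _ < n] / sigma ^+ 2))%:E.
Proof.
pose th2 := [tuple 2 * tnth theta i | i < n].
rewrite -[RHS]mule1 -(gauss_expect_likelihood th2) -gauss_expectZ ?expR_ge0//.
- congr gauss_expect; apply/funext => x; rewrite -EFinM; congr EFin.
  rewrite expr2 -!expRD; congr expR.
  rewrite /sqdist mulr_suml -!big_split/=; apply: eq_bigr => i _.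
  rewrite !tnth_mktuple; field.
  by rewrite gt_eqF.
- by apply/measurable_EFinP; exact: measurable_likelihood.
- by move=> x; rewrite lee_fin expR_ge0.
Qed.

End gauss_moments.

(** * Lower bound from a packing *)

Section sqdist_theory.
Variable R : realType.
Implicit Types n : nat.

Lemma sqdist_ge0 n (u v : n.-tuple R) : 0 <= sqdist u v.
Proof. by apply: sumr_ge0 => i _; exact: sqr_ge0. Qed.

Lemma sqdist0E n (th : n.-tuple R) :
  sqdist th [tuple 0 | _ < n] = \sum_i tnth th i ^+ 2.
Proof. by apply: eq_bigr => i _; rewrite tnth_mktuple subr0. Qed.

Lemma sqdist_triangle n (u v x : n.-tuple R) :
  sqdist u v <= 2 * (sqdist x u + sqdist x v).
Proof.
rewrite /sqdist -big_split mulr_sumr; apply: ler_sum => i _ /=.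
move: (tnth u i) (tnth v i) (tnth x i) => a b c.
have := sqr_ge0 (2 * c - a - b); rewrite !expr2; lra.
Qed.

Lemma measurable_sqdist d (T : measurableType d) n (f g : T -> n.-tuple R) :
  measurable_fun setT f -> measurable_fun setT g ->
  measurable_fun setT (fun t => sqdist (f t) (g t)).
Proof.
move=> mf mg; apply: measurable_sum => i; apply: measurable_funX.
by apply: measurable_funB;
  [move/measurable_fun_tnthP: mf|move/measurable_fun_tnthP: mg]; exact.
Qed.

End sqdist_theory.

Section lower_bound.
Variables (R : realType) (sigma : R).
Hypothesis sigma0 : 0 < sigma.

Lemma measurable_loss n (est : n.-tuple R -> n.-tuple R) theta :
  measurable_fun setT est ->
  measurable_fun setT (fun x => (sqdist (est x) theta)%:E).
Proof.
by move=> mest; apply/measurable_EFinP; exact: measurable_sqdist.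
Qed.

Lemma risk_ge0 n (est : n.-tuple R -> n.-tuple R) theta :
  (0 <= risk sigma est theta)%E.
Proof. by apply: gauss_expect_ge0 => x; rewrite lee_fin sqdist_ge0. Qed.

(* The balls of squared radius [d] around the [th j] are disjoint, so at most one
   loss is below [d]; its weight is absorbed by [L <= (t + L^2 / t) / 2]. *)
Lemma tilted_losses_ge n N (th : 'I_N -> n.-tuple R) (d t : R) (L : 'I_N -> R) x :
  0 <= d -> 0 < t -> (forall j, 0 <= L j) ->
  (forall i j, i != j -> 4 * d <= sqdist (th i) (th j)) ->
  d * \sum_j L j <= \sum_j L j * sqdist x (th j) +
     (d / (2 * t) * \sum_j L j ^+ 2 + d * t / 2).
Proof.
move=> d0 t0 L0 sep.
have amgm j : d * L j <= d / (2 * t) * L j ^+ 2 + d * t / 2.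
  have : 0 <= d / (2 * t) * (L j - t) ^+ 2.
    by rewrite mulr_ge0 ?sqr_ge0// divr_ge0// mulr_ge0// ltW.
  rewrite (_ : d / (2 * t) * (L j - t) ^+ 2 =
    d / (2 * t) * L j ^+ 2 + d * t / 2 - d * L j) ?subr_ge0//.
  by field; rewrite gt_eqF.
have sq0 : 0 <= d / (2 * t) by rewrite divr_ge0// mulr_ge0// ltW.
have [[j0 jd]|nj] := pselect (exists j, sqdist x (th j) < d); last first.
  rewrite -[leLHS]addr0 lerD//.
    rewrite mulr_sumr; apply: ler_sum => j _; rewrite mulrC ler_wpM2l//.
    by rewrite leNgt; apply/negP => h; apply: nj; exists j.
  apply: addr_ge0; last by rewrite divr_ge0// mulr_ge0// ltW.
  by rewrite mulr_ge0// sumr_ge0// => j _; exact: sqr_ge0.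
have sumD (F : 'I_N -> R) : \sum_j F j = F j0 + \sum_(i | i != j0) F i.
  by rewrite (bigD1 j0).
rewrite (sumD L) (sumD (fun j => L j * _)) (sumD (fun j => L j ^+ 2)) !mulrDr.
have h1 : d * \sum_(i | i != j0) L i <= \sum_(i | i != j0) L i * sqdist x (th i).
  rewrite mulr_sumr; apply: ler_sum => j jj0; rewrite mulrC ler_wpM2l//.
  by have := sqdist_triangle (th j) (th j0) x; have := sep _ _ jj0; lra.
have h2 : 0 <= L j0 * sqdist x (th j0) by rewrite mulr_ge0 ?sqdist_ge0.
have h3 : 0 <= d / (2 * t) * \sum_(i | i != j0) L i ^+ 2.
  by rewrite mulr_ge0// sumr_ge0// => j _; exact: sqr_ge0.
by have := amgm j0; lra.
Qed.

(* With [u ^ 4 = N], the second moments of the likelihoods are at most [u ^ 2], and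
   the choice [t = u ^ 3] above leaves a fraction [1 - 1 / u >= 1 / 8] of [d]. *)
Lemma minimax_ge_packing n k N (th : 'I_N -> n.-tuple R) (d : R) :
  (1 < N)%N -> 0 <= d -> (forall j, @Theta R n k (th j)) ->
  (forall j, sqdist (th j) [tuple 0 | _ < n] <= sigma ^+ 2 * (ln N%:R / 2)) ->
  (forall i j, i != j -> 4 * d <= sqdist (th i) (th j)) ->
  ((d / 8)%:E <= minimax_risk sigma n k)%E.
Proof.
move=> N1 d0 thT thn sep; apply: le_ereal_inf_tmp => _ [est mest <-].
set S := ereal_sup _.
have riskS j : (risk sigma est (th j) <= S)%E by apply: ereal_sup_ubound; exists (th j).
have S0 : (0 <= S)%E.
  by apply: le_trans (riskS (Ordinal (ltnW N1))); exact: risk_ge0.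
case: S S0 riskS => [r|_ _|//]; last by rewrite leey.
rewrite !lee_fin => r0 riskS.
have N0 : 0 < N%:R :> R by rewrite ltr0n ltnW.
have [u [u0 uN]] : exists u : R, 0 < u /\ u ^+ 4 = N%:R.
  exists (Num.sqrt (Num.sqrt N%:R)); rewrite !sqrtr_gt0; split => //.
  by rewrite (exprM _ 2 2) !sqr_sqrtr ?sqrtr_ge0 ?ltW.
have lnu : expR (ln N%:R / 2) = u ^+ 2.
  rewrite -uN lnXn// -[_ *+ 4]mulr_natr (_ : ln u * 4 / 2 = ln u * 2%:R).
    by rewrite expRM_natr lnK.
  by field.
pose t := u ^+ 3; have t0 : 0 < t by rewrite exprn_gt0.
pose L j := likelihood sigma (th j).
have L0 j x : 0 <= L j x by exact: expR_ge0.
have mL j : measurable_fun setT (L j) by exact: measurable_likelihood.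
have mLE j : measurable_fun setT (fun x => (L j x)%:E) by exact/measurable_EFinP.
have mL2 j : measurable_fun setT (fun x => (L j x ^+ 2)%:E).
  by apply/measurable_EFinP; exact: measurable_funX.
pose z := [tuple 0 : R | _ < n].
(* [tilted_losses_ge] at [est x], integrated under the law at 0; undoing the tilt turns each
   weighted loss into a risk, which is at most [r]. *)
have key : ((d * N%:R)%:E <= (\sum_(j < N) r)%:E +
     ((d / (2 * t) * \sum_(j < N) u ^+ 2)%:E + (d * t / 2)%:E))%E.
  have -> : ((d * N%:R)%:E = gauss_expect sigma z
      (fun x => \sum_(j < N) (d%:E * (L j x)%:E)))%E.
    rewrite gauss_expect_sum; last first.
    - by move=> j x; rewrite mule_ge0// lee_fin.
    - by move=> j; exact: emeasurable_funM.
    under eq_bigr => j _.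
      rewrite gauss_expectZ//; last by move=> x; rewrite lee_fin.
      rewrite gauss_expect_likelihood// mule1; over.
    by rewrite sumEFin sumr_const card_ord mulr_natr.
  apply: (@le_trans _ _ (gauss_expect sigma z (fun x =>
    \sum_(j < N) ((L j x)%:E * (sqdist (est x) (th j))%:E) +
    (\sum_(j < N) ((d / (2 * t))%:E * (L j x ^+ 2)%:E) + (d * t / 2)%:E))%E)).
    apply: gauss_expect_le.
    - by apply: emeasurable_sum => j; exact: emeasurable_funM.
    - apply: emeasurable_funD.
        apply: emeasurable_sum => j; apply: emeasurable_funM => //.
        exact: measurable_loss.
      apply: emeasurable_funD => //.
      by apply: emeasurable_sum => j; exact: emeasurable_funM.
    - by move=> x; apply: sume_ge0 => j _; rewrite mule_ge0// lee_fin.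
    - move=> x; under eq_bigr do rewrite -EFinM.
      under [X in (_ <= X + _)%E]eq_bigr do rewrite -EFinM.
      under [X in (_ <= _ + (X + _))%E]eq_bigr do rewrite -EFinM.
      rewrite !sumEFin -!EFinD lee_fin -!mulr_sumr.
      exact: tilted_losses_ge.
  have tp0 : 0 <= d / (2 * t) by rewrite divr_ge0// mulr_ge0// ltW.
  have m1 j : measurable_fun setT (fun x => (L j x)%:E * (sqdist (est x) (th j))%:E)%E.
    by apply: emeasurable_funM => //; exact: measurable_loss.
  have m2 j : measurable_fun setT (fun x => (d / (2 * t))%:E * (L j x ^+ 2)%:E)%E.
    exact: emeasurable_funM.
  have p1 j x : (0 <= (L j x)%:E * (sqdist (est x) (th j))%:E)%E.
    by rewrite mule_ge0// lee_fin ?sqdist_ge0.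
  have p2 j x : (0 <= (d / (2 * t))%:E * (L j x ^+ 2)%:E)%E.
    by rewrite mule_ge0// lee_fin ?sqr_ge0.
  have t20 : (0 <= (d * t / 2)%:E)%E.
    by rewrite lee_fin divr_ge0// mulr_ge0// ltW.
  rewrite gauss_expectD; first last.
  - by move=> x; rewrite adde_ge0// sume_ge0.
  - by move=> x; rewrite sume_ge0.
  - by apply: emeasurable_funD => //; exact: emeasurable_sum.
  - exact: emeasurable_sum.
  rewrite [X in (_ + X <= _)%E]gauss_expectD//; first last.
  - by move=> x; rewrite sume_ge0.
  - exact: emeasurable_sum.
  rewrite !gauss_expect_sum// gauss_expect_cst; apply: leeD.
    rewrite -sumEFin; apply: lee_sum => j _.
    rewrite -gauss_expect_tilt//; first exact: riskS.
      exact: measurable_loss.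
    by move=> x; rewrite lee_fin sqdist_ge0.
  apply: leeD => //; rewrite mulr_sumr -sumEFin; apply: lee_sum => j _.
  rewrite gauss_expectZ//; last first.
  - by move=> x; rewrite lee_fin sqr_ge0.
  rewrite gauss_expect_likelihood2// -EFinM lee_fin ler_wpM2l//.
  by rewrite -lnu ler_expR ler_pdivrMr ?exprn_gt0// mulrC.
rewrite -!EFinD lee_fin !sumr_const !card_ord -(mulr_natr r) -(mulr_natr (u ^+ 2)) -uN in key.
(* [(8 / 7) ^ 4 < 2 <= N]. *)
have u87 : 8 / 7 <= u.
  rewrite -(@ler_pXn2r _ 4) ?nnegrE ?(ltW u0)// uN.
  by apply: (@le_trans _ _ 2); [lra|rewrite ler_nat].
have {}key : d * (u ^+ 4 - u ^+ 3) <= r * u ^+ 4.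
  move: key; rewrite (_ : d / (2 * t) * (u ^+ 2 * u ^+ 4) + d * t / 2 = d * u ^+ 3).
    by lra.
  by rewrite /t; field; rewrite gt_eqF.
rewrite -(@ler_pM2r _ (u ^+ 4)) ?exprn_gt0//; apply: le_trans key.
rewrite mulrAC -mulrA ler_wpM2l//.
have -> : u ^+ 4 / 8 = u ^+ 4 - u ^+ 3 - u ^+ 3 * (7 * u / 8 - 1) by field.
by rewrite lerBlDr lerDl mulr_ge0 ?exprn_ge0 ?(ltW u0)//; lra.
Qed.

End lower_bound.

(** * Packings of piecewise constant vectors *)

Section theta_members.
Variable R : realType.

(** The extra breakpoints are all put at [n], so the added pieces are empty. *)
Lemma Theta_le n k k' : (0 < k)%N -> (k <= k')%N ->
  @Theta R n k `<=` @Theta R n k'.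
Proof.
move=> k0 kk' th [a [mu [a0 ak amono amu]]].
exists (fun j => if (j <= k)%N then a j else n), mu; split.
- by rewrite leq0n.
- by case: ifPn => // k'k; rewrite -ak; congr a; lia.
- move=> j jk'; case: (leqP j.+1 k) => jk; first by rewrite (ltnW jk) amono.
  by case: ifP => // jk2; rewrite -ak (_ : j = k)//; lia.
- move=> i j jk' ij; have ltn_i := ltn_ord i.
  have jk : (j <= k)%N.
    rewrite leqNgt; apply/negP => kj; move/andP: ij => [+ _]; case: ifP => j1k.
      by rewrite (_ : j.-1 = k) ?ak; lia.
    by lia.
  apply: (amu i j); first by lia.
  by move: ij; rewrite jk (_ : (j.-1 <= k)%N)//; lia.
Qed.

Lemma Theta_cst n (x : R) : @Theta R n 1 [tuple x | _ < n].
Proof.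
exists (fun j => if j is 0%N then 0%N else n), (fun=> x); split => //.
  by case.
by move=> i j _ _; rewrite tnth_mktuple.
Qed.

Lemma Theta_step n l (x : R) : (l <= n)%N ->
  @Theta R n 2 [tuple if (i < l)%N then x else 0 | i < n].
Proof.
move=> ln; exists (fun j => match j with 0%N => 0%N | 1%N => l | _ => n end),
  (fun j => if j == 1%N then x else 0); split => //.
- by case=> [|[|j]].
- move=> i [|[|[|j]]] //= _; rewrite tnth_mktuple; first by move=> ->.
  by case: ltnP.
Qed.

(* Piece [2 s + 2] is the singleton [q s]; the odd pieces are the gaps. *)
Lemma Theta_spikes n m (q : nat -> nat) (h : R) :
  (forall s s', (s < s' < m)%N -> (q s < q s')%N) ->
  (forall s, (s < m)%N -> (q s < n)%N) ->
  @Theta R n (2 * m).+1 [tuple if [exists s : 'I_m, q s == i] then h else 0 | i < n].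
Proof.
move=> qinc qn.
(* For [s < m] this gives [a (2 s + 1) = q s] and [a (2 s + 2) = q s + 1], so piece [2 s + 2]
   consists of the zero-based index [q s] alone. *)
pose a j := if j == 0%N then 0%N else
  if j == (2 * m).+1 then n else (q (j.-1)./2 + ~~ odd j)%N.
have qle s s' : (s <= s')%N -> (s' < m)%N -> (q s <= q s')%N.
  rewrite leq_eqVlt => /orP[/eqP->//|ss' s'm]; apply: ltnW; apply: qinc; lia.
have aE j : (0 < j < (2 * m).+1)%N -> a j = (q (j.-1)./2 + ~~ odd j)%N.
  by move=> jm; rewrite /a !ifF//; lia.
exists a, (fun j => if odd j then 0 else h); split => //.
- by rewrite /a /= eqxx.
- move=> [|j] jm; first by rewrite /a.
  rewrite /a /=.
  have [e|ne] := eqVneq j.+2 (2 * m).+1.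
    rewrite ifF; last by lia.
    by have := qn j./2; case: (odd j) (odd_double_half j); lia.
  rewrite ifF; last by lia.
  case oj: (odd j) => /=.
    have : (q j./2 < q (uphalf j))%N by apply: qinc; lia.
    lia.
  by rewrite (_ : uphalf j = j./2); lia.
- move=> i j jm ij; rewrite tnth_mktuple.
  case oj: (odd j); last first.
    rewrite ifT//; apply/existsP.
    have jm2 : (j.-1./2 < m)%N by lia.
    exists (Ordinal jm2) => /=; move: ij; rewrite !aE; [|lia..].
    rewrite oj (_ : odd j.-1 = true)/=; last by lia.
    by rewrite (_ : j.-1.-1./2 = j.-1./2); lia.
  rewrite ifF//; apply/negbTE/existsPn => s; apply/negP => /eqP qs.
  have sm := ltn_ord s; move/andP: ij => [ij1 ij2].
  have [sj|sj] := leqP j.-1./2 s.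
    by move: ij2; rewrite aE ?oj; [have := qle _ _ sj sm|]; lia.
  move: ij1; rewrite aE; last by lia.
  have : (q s <= q j.-1.-1./2)%N by apply: qle; lia.
  by lia.
Qed.

End theta_members.

(** * Codes with large Hamming distance *)

Section gilbert.
Variables m L : nat.
Hypothesis L0 : (0 < L)%N.
Local Close Scope classical_set_scope.
Local Open Scope set_scope.
Local Notation T := {ffun 'I_m -> 'I_L}.

Definition hamming (f g : T) : nat := #|[set s | f s != g s]|.

Lemma hammingC f g : hamming f g = hamming g f.
Proof. by apply: eq_card => s; rewrite !inE eq_sym. Qed.

Lemma hammingxx f : hamming f f = 0%N.
Proof. by apply/eqP; rewrite cards_eq0; apply/eqP/setP => s; rewrite !inE eqxx. Qed.

Lemma leq_card_bigcup (I X : finType) (P : pred I) (F : I -> {set X}) :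
  (#|\bigcup_(i | P i) F i| <= \sum_(i | P i) #|F i|)%N.
Proof.
elim/big_rec2: _ => [|i n A _ le_An]; first by rewrite cards0.
by rewrite (leq_trans (leq_card_setU _ _))// leq_add2l.
Qed.

(** A word of the ball is determined by the set of places where it differs from [c], with at most
    [2 ^ m] choices, and by its letters there, with at most [L ^ r] choices. *)
Lemma card_hamming_ball (c : T) r :
  (#|[set g | (hamming c g <= r)%N]| <= 2 ^ m * L ^ r)%N.
Proof.
have cover : [set g | (hamming c g <= r)%N] \subset
    \bigcup_(A : {set 'I_m} | (#|A| <= r)%N)
      [set g in family (fun s => if s \in A then predT else pred1 (c s))].
  apply/fintype.subsetP => g; rewrite inE => gr; apply/finset.bigcupP.
  exists [set s | c s != g s] => //; rewrite inE; apply/familyP => s.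
  by rewrite inE; case: eqP => // ->; rewrite inE.
apply: leq_trans (subset_leq_card cover) _.
apply: leq_trans (leq_card_bigcup _ _) _.
apply: (@leq_trans (\sum_(A : {set 'I_m} | (#|A| <= r)%N) L ^ r)).
  apply: leq_sum => A Ar; rewrite cardsE card_family foldrE big_image/=.
  rewrite (bigID (mem A))/= [X in (_ * X)%N]big1 ?muln1; last first.
    by move=> s /negbTE sA; rewrite sA card1.
  rewrite (eq_bigr (fun=> L)); last by move=> s ->; rewrite card_ord.
  by rewrite prod_nat_const leq_pexp2l.
rewrite sum_nat_const leq_mul2r; apply/orP; right.
rewrite (leq_trans (max_card _))//.
by rewrite -cardsT -powersetT card_powerset cardsT card_ord.
Qed.

(* A maximal r-separated code: the balls of radius r around it cover everything. *)
Lemma gilbert_varshamov r : exists C : {set T},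
  (forall f g, f \in C -> g \in C -> f != g -> (r < hamming f g)%N) /\
  (L ^ m <= #|C| * (2 ^ m * L ^ r))%N.
Proof.
pose sep (C : {set T}) := [forall f in C, forall g in C, (f != g) ==> (r < hamming f g)%N].
have sep0 : sep finset.set0 by apply/forall_inP => f; rewrite inE.
have [C sepC maxC] := arg_maxnP (fun C : {set T} => #|C|) sep0.
exists C; split.
  by move=> f g fC gC; move/forall_inP: sepC => /(_ f fC) /forall_inP /(_ g gC) /implyP.
have cover : [set: T] \subset \bigcup_(c in C) [set g | (hamming c g <= r)%N].
  apply/fintype.subsetP => g _; apply/finset.bigcupP.
  have [/existsP[c /andP[cC cg]]|nex] := boolP [exists c, (c \in C) && (hamming c g <= r)%N].
    by exists c => //; rewrite inE.
  exfalso; move/existsPn: nex => nex.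
  have far c : c \in C -> (r < hamming c g)%N.
    by move=> cC; have := nex c; rewrite cC /= -ltnNge.
  have gC : g \notin C by apply/negP => /far; rewrite hammingxx.
  have : sep (g |: C).
    apply/forall_inP => f /setU1P[->|fC]; apply/forall_inP => h /setU1P[->|hC];
      apply/implyP => fh.
    - by rewrite eqxx in fh.
    - by rewrite hammingC far.
    - by rewrite far.
    - by move/forall_inP: sepC => /(_ f fC) /forall_inP /(_ h hC) /implyP; exact.
  by move/maxC => /=; rewrite cardsU1 gC add1n ltnn.
have := subset_leq_card cover; rewrite cardsT card_ffun !card_ord => /leq_trans; apply.
apply: leq_trans (leq_card_bigcup _ _) _.
rewrite -sum_nat_const; apply: leq_sum => c _; exact: card_hamming_ball.
Qed.

End gilbert.

(** * Elementary estimates *)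

Section logarithm.
Variable R : realType.

Lemma ln2_ge_half : 1 / 2 <= ln 2 :> R.
Proof.
rewrite -ler_expR lnK ?posrE//.
have : expR (1 / 2 : R) * expR (- (1 / 2)) = 1 by rewrite -expRD subrr expR0.
have := expR_ge1Dx (- (1 / 2) : R); have := expR_gt0 (1 / 2 : R).
move: (expR (1 / 2)) (expR (- (1 / 2))) => a b; nra.
Qed.

Lemma ln_le_subr1 (x : R) : 0 < x -> ln x <= x - 1.
Proof. by move=> x0; have := @le_ln1Dx R (x - 1); rewrite addrCA subrr addr0; apply; lra. Qed.

Lemma ln2_le1 : ln 2 <= 1 :> R.
Proof. by have := @ln_le_subr1 2; rewrite ltr0n => /(_ isT); lra. Qed.

Lemma lnX_natr (x : R) n : 0 < x -> ln (x ^+ n) = n%:R * ln x.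
Proof. by move=> x0; rewrite lnXn// mulr_natl. Qed.

Lemma ln_ge1 n : (16 <= n)%N -> 1 <= ln n%:R :> R.
Proof.
move=> n16; apply: (@le_trans _ _ (ln (2 ^+ 4))).
  by rewrite lnX_natr//; have := ln2_ge_half; lra.
by rewrite ler_ln ?posrE ?exprn_gt0// -?natrX ?ler_nat// ltr0n; lia.
Qed.

Lemma sum_ord_itv n a b (x : R) : (a <= b)%N -> (b <= n)%N ->
  \sum_(i < n) (if (a <= i < b)%N then x else 0) = (b - a)%:R * x.
Proof.
move=> ab bn; rewrite -(big_mkord xpredT (fun i => if (a <= i < b)%N then x else 0)).
rewrite (big_cat_nat (n := b))//= (big_cat_nat (n := a))//=.
rewrite big_nat_cond big1 ?add0r; last by move=> i ?; rewrite ifF//; lia.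
rewrite [X in _ + X]big_nat_cond [X in _ + X]big1 ?addr0; last first.
  by move=> i ?; rewrite ifF//; lia.
rewrite big_nat_cond (eq_bigr (fun=> x)); last by move=> i ?; rewrite ifT//; lia.
by rewrite -big_nat_cond sumr_const_nat mulr_natl.
Qed.

End logarithm.

(** * Lower bounds in the three regimes *)

Section lower_bounds.
Variables (R : realType) (sigma : R).
Hypothesis sigma0 : 0 < sigma.

Lemma minimax_mono n k k' : (0 < k)%N -> (k <= k')%N ->
  (minimax_risk sigma n k <= minimax_risk sigma n k')%E.
Proof.
move=> k0 kk'; apply: le_ereal_inf_tmp => _ [est mest <-].
apply: (@le_trans _ _ (ereal_sup [set risk sigma est theta | theta in @Theta R n k])).
  by apply: ereal_inf_lbound; exists est.
by apply: ereal_sup_le => _ [th thT <-]; exists th => //; exact: Theta_le thT.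
Qed.

(** The constant vectors with entries [h] and [- h] have squared norm [sigma ^ 2 / 4] and squared
    distance [sigma ^ 2]. Monotonicity in [k] makes this available for small [n] in the other
    regimes. *)
Lemma minimax_lower_const n k : (0 < k)%N -> (0 < n)%N ->
  ((sigma ^+ 2 / 64)%:E <= minimax_risk sigma n k)%E.
Proof.
move=> k0 n0; apply: le_trans (minimax_mono n (ltnSn 0) k0).
have n0' : 0 < n%:R :> R by rewrite ltr0n.
pose h := sigma / 2 / Num.sqrt n%:R.
have h2 : h ^+ 2 = sigma ^+ 2 / 4 / n%:R.
  by rewrite /h !expr_div_n sqr_sqrtr ?ler0n//; field; rewrite gt_eqF.
pose th (j : 'I_2) := [tuple (if j == ord0 then h else - h) | _ < n].
rewrite (_ : sigma ^+ 2 / 64 = (sigma ^+ 2 / 8) / 8); last by field.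
apply: (@minimax_ge_packing R sigma sigma0 n 1 2 th) => //.
- by rewrite divr_ge0// sqr_ge0.
- by move=> j; exact: Theta_cst.
- move=> j; rewrite sqdist0E (eq_bigr (fun=> h ^+ 2)); last first.
    by move=> i _; rewrite tnth_mktuple; case: ifP; rewrite ?sqrrN.
  rewrite sumr_const card_ord h2 -[leLHS]mulr_natr divfK ?gt_eqF//.
  by rewrite ler_wpM2l ?sqr_ge0//; have := ln2_ge_half R; lra.
- move=> i j ij; rewrite /sqdist (eq_bigr (fun=> 4 * h ^+ 2)); last first.
    move=> l _; rewrite !tnth_mktuple; move: ij.
    case: i => [[|[|//]] ?]; case: j => [[|[|//]] ?] //= _; ring.
  rewrite sumr_const card_ord h2 -[leRHS]mulr_natr.
  rewrite (_ : 4 * (sigma ^+ 2 / 4 / n%:R) * n%:R = sigma ^+ 2); last first.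
    by field; rewrite gt_eqF.
  by have := sqr_ge0 sigma; lra.
Qed.

(** Steps of lengths [4 ^ i < 4 ^ j] differ by [h j] on at least three quarters of the longer one,
    so their squared distance is at least [3 / 4] of the common squared norm. *)
Lemma minimax_lower_two n : (2 <= n)%N ->
  ((4096^-1 * (sigma ^+ 2 * ln (ln (16 * n%:R))))%:E <= minimax_risk sigma n 2)%E.
Proof.
move=> n2.
have n0 : 0 < n%:R :> R by rewrite ltr0n; lia.
have ln16 : 1 <= ln (16 * n%:R) :> R.
  by rewrite -natrM ln_ge1//; lia.
have s2 := sqr_ge0 sigma.
(* For [n < 4] the iterated logarithm is bounded and the constant lower bound suffices. *)
have [n4|n4] := ltnP n 4.
  apply: le_trans (minimax_lower_const (isT : 0 < 2)%N _); last by lia.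
  rewrite lee_fin.
  have : ln (ln (16 * n%:R)) <= 46 :> R.
    apply: le_trans (ln_le_subr1 _) _; first by lra.
    have := @ln_le_subr1 R (16 * n%:R); have : n%:R <= 3%:R :> R by rewrite ler_nat.
    by rewrite mulr_gt0// => ? /(_ isT); lra.
  by nra.
(* The number of powers of 4, starting with [4 ^ 0], that do not exceed [n]. *)
pose N := (trunc_log 4 n).+1.
have N2 : (2 <= N)%N by rewrite /N ltnS trunc_log_gt0.
have Nn : (4 ^ N.-1 <= n)%N by rewrite /N/= trunc_logP//; lia.
have nN : (n < 4 ^ N)%N by exact: trunc_log_ltn.
have N0 : 0 < N%:R :> R by rewrite ltr0n; lia.
have N2R : 2 <= N%:R :> R by rewrite (ler_nat _ 2).
have lnN0 : 0 <= ln N%:R :> R by rewrite ln_ge0//; lra.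
(* [16 n <= 2 ^ (2 (N + 2))], and [2 (N + 2) <= N ^ 3] as soon as [N >= 2]. *)
have lnln : ln (ln (16 * n%:R)) <= 3 * ln N%:R :> R.
  rewrite (_ : 3 * ln N%:R = ln (N%:R ^+ 3)); last by rewrite lnX_natr.
  rewrite ler_ln ?posrE ?exprn_gt0//; last by lra.
  apply: (@le_trans _ _ (ln (2 ^+ (2 * (N + 2))))).
    rewrite ler_ln ?posrE ?mulr_gt0// ?exprn_gt0//.
    rewrite exprM exprD mulrC (_ : (2 ^+ 2 : R) ^+ 2 = 16); last by ring.
    rewrite ler_wpM2r// (_ : 2 ^+ 2 = 4%:R :> R); last by ring.
    by rewrite -natrX ler_nat ltnW.
  rewrite lnX_natr// natrM natrD.
  have l2 := ln2_le1 R.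
  have l20 := ln2_ge_half R.
  apply: (@le_trans _ _ (2 * (N%:R + 2))); first by nra.
  by rewrite !exprS expr0 mulr1; nra.
apply: (@le_trans _ _ ((3 / 32 * (sigma ^+ 2 * ln N%:R)) / 8)%:E).
  by rewrite lee_fin; nra.
pose h (j : nat) := sigma * Num.sqrt (ln N%:R / 2) / 2 ^+ j.
have h2 j : h j ^+ 2 = sigma ^+ 2 * (ln N%:R / 2) / (4 ^ j)%:R.
  rewrite /h expr_div_n exprMn sqr_sqrtr ?divr_ge0//; congr (_ / _).
  by rewrite natrX exprAC; congr (_ ^+ _); ring.
have p4 j : 0 < (4 ^ j)%:R :> R by rewrite ltr0n expn_gt0.
have le4 (j : 'I_N) : (4 ^ j <= n)%N.
  by apply: leq_trans Nn; rewrite leq_pexp2l//; have := ltn_ord j; lia.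
pose th (j : 'I_N) := [tuple if (i < 4 ^ j)%N then h j else 0 | i < n].
have c0 : 0 <= sigma ^+ 2 * (ln N%:R / 2) by rewrite mulr_ge0// divr_ge0.
have sep (i j : 'I_N) : (i < j)%N ->
    4 * (3 / 32 * (sigma ^+ 2 * ln N%:R)) <= sqdist (th i) (th j).
  move=> ij.
  have ij4 : (4 * 4 ^ i <= 4 ^ j)%N by rewrite -expnS leq_pexp2l.
  apply: (@le_trans _ _ (\sum_(l < n) (if (4 ^ i <= l < 4 ^ j)%N then h j ^+ 2 else 0))).
    rewrite sum_ord_itv//; last by lia.
    rewrite h2 natrB; last by lia.
    have : 4 * (4 ^ i)%:R <= (4 ^ j)%:R :> R by rewrite -natrM ler_nat.
    move: (p4 j) => + q; move: (4 ^ i)%:R (4 ^ j)%:R q => x y xy y0.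
    rewrite [leRHS]mulrA ler_pdivlMr//.
    have : 0 <= (sigma ^+ 2 * (ln N%:R / 2)) * (y - 4 * x) by rewrite mulr_ge0// subr_ge0.
    by lra.
  apply: ler_sum => l _; rewrite !tnth_mktuple.
  case: ifP => [lij|_]; last exact: sqr_ge0.
  by rewrite ifF ?ifT; [rewrite add0r sqrrN|lia..].
apply: (@minimax_ge_packing R sigma sigma0 n 2 N th) => //.
- by lra.
- by move=> j; exact: Theta_step.
- move=> j; rewrite sqdist0E.
  rewrite (eq_bigr (fun l : 'I_n => if (0 <= l < 4 ^ j)%N then h j ^+ 2 else 0)); last first.
    by move=> l _; rewrite tnth_mktuple leq0n/=; case: ifP => //; rewrite expr0n.
  by rewrite sum_ord_itv// subn0 h2 mulrC divfK// gt_eqF.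
- move=> i j; rewrite neq_ltn => /orP[/sep//|/sep].
  by rewrite /sqdist; under [X in _ -> _ <= X]eq_bigr do rewrite -sqrrN opprB.
Qed.

Section spikes.
Variables n m L : nat.
Hypotheses (m0 : (0 < m)%N) (L16 : (16 <= L)%N) (mLn : (m * L <= n)%N).
Local Notation T := {ffun 'I_m -> 'I_L}.

(** Segment [s] has length [L] and its spike sits at offset [f s]. [Theta_spikes] takes positions
    indexed by [nat], hence the default offset 0 out of range. *)
Let pos (f : T) s : nat := s * L + oapp (fun s' : 'I_m => val (f s')) 0%N (insub s).

Let posE f (s : 'I_m) : pos f s = (s * L + f s)%N.
Proof. by rewrite /pos valK. Qed.

Let pos_lt f s : (s < m)%N -> (pos f s < n)%N.
Proof.
by move=> sm; rewrite -[s]/(val (Ordinal sm)) posE /=;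
  have := ltn_ord (f (Ordinal sm)); nia.
Qed.

Let pos_inc f s s' : (s < s' < m)%N -> (pos f s < pos f s')%N.
Proof.
move=> /andP[ss' s'm]; have sm := ltn_trans ss' s'm.
rewrite -[s]/(val (Ordinal sm)) -[s']/(val (Ordinal s'm)) !posE /=.
by have := ltn_ord (f (Ordinal sm)); nia.
Qed.

Let pos_inj f g (s s' : 'I_m) : pos f s = pos g s' -> s = s' /\ f s = g s'.
Proof.
rewrite !posE => e.
have ss' : s = s'.
  apply: val_inj; have /= := congr1 (divn^~ L) e.
  by rewrite !divnMDl ?(divn_small (ltn_ord _)) ?addn0//; lia.
split=> //; apply: val_inj; move: e; rewrite ss' => /eqP.
by rewrite eqn_add2l => /eqP.
Qed.

Let spike (h : R) f := [tuple if [exists s : 'I_m, pos f s == i] then h else 0 | i < n].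

Let spike_norm h f : sqdist (spike h f) [tuple 0 | _ < n] <= m%:R * h ^+ 2.
Proof.
rewrite sqdist0E.
apply: (@le_trans _ _ (\sum_(i < n) \sum_(s < m) (if pos f s == i then h ^+ 2 else 0))).
  apply: ler_sum => i _; rewrite tnth_mktuple; case: ifP => [/existsP[s sE]|_].
    rewrite (bigD1 s)//= sE lerDl sumr_ge0// => s' _.
    by case: ifP => // _; exact: sqr_ge0.
  by rewrite expr0n sumr_ge0// => s' _; case: ifP => // _; exact: sqr_ge0.
rewrite exchange_big/= -[m in leRHS]card_ord -sum1_card natr_sum mulr_suml.
apply: ler_sum => s _; rewrite -big_mkcond/= (big_pred1 (Ordinal (pos_lt f (ltn_ord s)))).
  by rewrite mul1r.
by move=> i /=; rewrite eq_sym -val_eqE.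
Qed.

(** Only the spikes of [f] in segments where [f] and [g] differ are counted; [g] has no spike there,
    because a position determines its segment and its offset. *)
Let spike_sep h f g : (hamming f g)%:R * h ^+ 2 <= sqdist (spike h f) (spike h g).
Proof.
pose Q s := Ordinal (pos_lt f (ltn_ord s)) : 'I_n.
have Qinj : injective Q by move=> s s' [] /pos_inj[].
rewrite /hamming -sum1_card natr_sum mulr_suml.
set A := finset _.
apply: (@le_trans _ _ (\sum_(i in imset Q (mem A))
    (tnth (spike h f) i - tnth (spike h g) i) ^+ 2)).
  rewrite big_imset/=; last by move=> s s' _ _; exact: Qinj.
  apply: ler_sum => s; rewrite inE => fg; rewrite !tnth_mktuple.
  rewrite ifT; last by apply/existsP; exists s.
  rewrite ifF ?subr0 ?mul1r//; apply/negbTE/existsPn => s'; apply/negP => /eqP.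
  by move=> /= /pos_inj[ss' e]; move: fg; rewrite -e ss' eqxx.
rewrite big_mkcond/=; apply: ler_sum => i _; case: ifP => // _; exact: sqr_ge0.
Qed.

Lemma minimax_lower_spikes :
  ((sigma ^+ 2 * m%:R * ln L%:R / 512)%:E <= minimax_risk sigma n (2 * m).+1)%E.
Proof.
have L0 : (0 < L)%N by lia.
have [C [sepC cardC]] := gilbert_varshamov m L0 m./2.
pose N := #|C|.
(* [L >= 16] gives [2 ^ m <= L ^ (m / 4)], so the code has at least [L ^ (m / 4)] words; fourth
   powers keep the computation in the integers. *)
have N4 : (L ^ m <= N ^ 4)%N.
  have P0 : (0 < L ^ m)%N by rewrite expn_gt0 L0.
  have h1 : ((2 ^ m) ^ 4 <= L ^ m)%N.
    by rewrite -expnM mulnC expnM leq_exp2r.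
  have h2 : ((L ^ m./2) ^ 4 <= (L ^ m) ^ 2)%N.
    by rewrite -!expnM leq_pexp2l//; lia.
  have h3 : ((L ^ m) ^ 4 <= N ^ 4 * ((2 ^ m) ^ 4 * (L ^ m./2) ^ 4))%N.
    by rewrite -!expnMn leq_exp2r.
  have h4 : ((L ^ m) ^ 4 <= N ^ 4 * (L ^ m * (L ^ m) ^ 2))%N.
    by apply: (leq_trans h3); rewrite leq_mul2l (leq_mul h1 h2) orbT.
  move: h4; rewrite -expnS [(_ ^ 4)%N in X in (X <= _)%N -> _]expnS leq_pmul2r//.
  by rewrite expn_gt0 P0.
have N2 : (2 <= N)%N.
  rewrite -(@leq_exp2r _ _ 4)//; apply: leq_trans N4.
  by rewrite (leq_trans L16)// -[X in (X <= _)%N]expn1 leq_pexp2l.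
have N0 : 0 < N%:R :> R by rewrite ltr0n; lia.
have LR0 : 0 < L%:R :> R by rewrite ltr0n.
have lnL0 : 0 <= ln L%:R :> R by rewrite ln_ge0// ler1n.
have lnN : m%:R * ln L%:R <= 4 * ln N%:R :> R.
  rewrite -!lnX_natr// ler_ln ?posrE ?exprn_gt0//.
  by rewrite -!natrX ler_nat.
(* Since [ln N >= m ln L / 4], the divisor 8 makes [m h ^ 2] at most [sigma ^ 2 ln N / 2], as the
   packing bound requires. *)
pose h := sigma * Num.sqrt (ln L%:R / 8).
have h2 : h ^+ 2 = sigma ^+ 2 * (ln L%:R / 8).
  by rewrite /h exprMn sqr_sqrtr// divr_ge0.
have s2 := sqr_ge0 sigma.
pose th (j : 'I_N) := spike h (enum_val j).
rewrite (_ : _ / 512 = (sigma ^+ 2 * m%:R * ln L%:R / 64) / 8); last by field.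
have sml0 : 0 <= sigma ^+ 2 * m%:R * ln L%:R by rewrite mulr_ge0// mulr_ge0// ler0n.
apply: (@minimax_ge_packing R sigma sigma0 n _ N th) => //.
- by rewrite divr_ge0.
- by move=> j; apply: Theta_spikes => *; [exact: pos_inc|exact: pos_lt].
- move=> j; apply: le_trans (spike_norm _ _) _; rewrite h2.
  by nra.
- move=> i j ij; apply: le_trans (spike_sep _ _ _).
  have : m%:R / 2 <= (hamming (enum_val i) (enum_val j))%:R :> R.
    have : (m <= 2 * hamming (enum_val i) (enum_val j))%N.
      have := sepC _ _ (enum_valP i) (enum_valP j).
      by rewrite (inj_eq enum_val_inj) => /(_ ij); lia.
    by rewrite -(ler_nat R) natrM; lra.
  rewrite h2; have : 0 <= sigma ^+ 2 * ln L%:R by rewrite mulr_ge0.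
  by nra.
Qed.

End spikes.

Lemma minimax_lower_many n k : (3 <= k <= n)%N ->
  ((512^-1 * (64^-1 * (sigma ^+ 2 * k%:R * ln (expR 1 * n%:R / k%:R))))%:E <=
    minimax_risk sigma n k)%E.
Proof.
move=> /andP[k3 kn].
have k0 : 0 < k%:R :> R by rewrite ltr0n; lia.
have n0 : 0 < n%:R :> R by rewrite ltr0n; lia.
have s2 := sqr_ge0 sigma.
have lnE : ln (expR 1 * n%:R / k%:R) = 1 + ln (n%:R / k%:R) :> R.
  by rewrite -mulrA lnM ?posrE ?expR_gt0 ?divr_gt0// expRK.
have kln : k%:R * ln (expR 1 * n%:R / k%:R) <= n%:R :> R.
  rewrite lnE; have := @ln_le_subr1 R (n%:R / k%:R); rewrite divr_gt0// => /(_ isT) h.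
  have : k%:R * (1 + ln (n%:R / k%:R)) <= k%:R * (n%:R / k%:R) :> R.
    by rewrite ler_wpM2l ?(ltW k0)//; lra.
  by rewrite [X in _ <= X -> _]mulrC divfK// gt_eqF.
(* By [kln] the rate is then at most [15 sigma ^ 2]. *)
have [n16|n16] := ltnP n 16.
  apply: le_trans (minimax_lower_const _ _); [|lia..].
  rewrite lee_fin -mulrA.
  have : n%:R <= 15%:R :> R by rewrite ler_nat.
  by nra.
(* [2 m + 1 <= k] provides the pieces for [m] spikes, and [16 m <= n] makes the segments at least 16
   long. *)
pose m := minn (k.-1)./2 (n %/ 16).
have m0 : (0 < m)%N by rewrite /m; lia.
pose L := (n %/ m)%N.
have L16 : (16 <= L)%N by rewrite /L leq_divRL//; rewrite /m; lia.
have mLn : (m * L <= n)%N by rewrite mulnC leq_trunc_div.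
have nmL : (n < m * L.+1)%N by rewrite mulnC ltn_ceil.
have mk : ((2 * m).+1 <= k)%N by rewrite /m; lia.
apply: le_trans (minimax_mono n (ltn0Sn _) mk).
apply: le_trans (minimax_lower_spikes m0 L16 mLn); rewrite lee_fin.
have LR0 : 0 < L%:R :> R by rewrite ltr0n; lia.
have m0R : 0 < m%:R :> R by rewrite ltr0n.
have lnL : 1 <= ln L%:R :> R by exact: ln_ge1.
suff : k%:R * ln (expR 1 * n%:R / k%:R) <= 64 * (m%:R * ln L%:R) :> R.
  by rewrite -!mulrA; nra.
(* If [k] limits [m], then [k <= 4 m] and [n / k <= L]. Otherwise [m] is of order [n], and [kln]
   with [n <= 32 m] concludes. *)
have [mE|mE] := leqP (k.-1)./2 (n %/ 16).
  have mE' : m = (k.-1)./2 by rewrite /m; lia.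
  have k4m : k%:R <= 4 * m%:R :> R by rewrite -natrM ler_nat mE'; lia.
  have lnk : ln (n%:R / k%:R) <= ln L%:R :> R.
    rewrite ler_ln ?posrE ?divr_gt0// ler_pdivrMr// -natrM ler_nat.
    by rewrite (leq_trans (ltnW nmL))// (leq_trans _ (leq_mul (leqnn L) mk))//; nia.
  have : 0 <= ln (n%:R / k%:R) :> R.
    by rewrite ln_ge0// ler_pdivlMr// mul1r ler_nat.
  rewrite lnE; nra.
have mE' : m = (n %/ 16)%N by rewrite /m; lia.
apply: (le_trans kln); apply: (@le_trans _ _ (32 * m%:R)); last by nra.
by rewrite -natrM ler_nat mE'; lia.
Qed.

End lower_bounds.

(** * Least squares over a family of partitions *)

Section argmin.
Variables (R : realType) (d d' : measure_display).
Variables (X : measurableType d) (Y : measurableType d').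

(** The new candidate is compared with the minimiser over the rest of the list; the cost hypothesis
    covers all measurable [f] so that it applies to this minimiser. *)
Lemma measurable_argmin (I : eqType) (s : seq I) (p : I -> X -> Y)
    (cost : X -> Y -> R) : s != [::] ->
  (forall i, measurable_fun setT (p i)) ->
  (forall f, measurable_fun setT f -> measurable_fun setT (fun x => cost x (f x))) ->
  exists f : X -> Y, [/\ measurable_fun setT f,
    forall x, exists2 i, i \in s & f x = p i x &
    forall x i, i \in s -> cost x (f x) <= cost x (p i x)].
Proof.
move=> + mp mcost; elim: s => // i s IH _.
have [->|s0] := eqVneq s [::].
  by exists (p i); split=> // x; [exists i; rewrite ?inE|move=> j; rewrite inE => /eqP->].
have [f [mf fs fmin]] := IH s0.
exists (fun x => if cost x (p i x) <= cost x (f x) then p i x else f x); split.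
- by apply: measurable_fun_ifT => //; apply: measurable_fun_ler; exact: mcost.
- move=> x; case: ifP => _; first by exists i; rewrite ?inE ?eqxx.
  by have [j js fE] := fs x; exists j; rewrite // inE js orbT.
- move=> x j; rewrite inE => /predU1P[->|js].
    by have [|/ltW] := leP (cost x (p i x)) (cost x (f x)).
  have [h|_] := leP (cost x (p i x)) (cost x (f x)); last exact: fmin.
  by apply: (le_trans h); exact: fmin.
Qed.

End argmin.

Section projection.
Variable R : realType.

(** The orthogonal projection onto the vectors that are constant on the level sets of [b]. *)
Definition block_avg n (B : eqType) (b : 'I_n -> B) (x : n.-tuple R) : n.-tuple R :=
  [tuple (\sum_(l | b l == b i) tnth x l) / #|[pred l | b l == b i]|%:R | i < n].

Lemma measurable_block_avg n (B : eqType) (b : 'I_n -> B) :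
  measurable_fun setT (block_avg b).
Proof.
apply/measurable_fun_tnthP => i; rewrite /comp/=.
rewrite (_ : (fun x => _) = (fun x : n.-tuple R =>
  (\sum_(l | b l == b i) tnth x l) / #|[pred l | b l == b i]|%:R)); last first.
  by apply/funext => x; rewrite tnth_mktuple.
apply: measurable_funM => //.
rewrite (_ : (fun x : n.-tuple R => \sum_(l | b l == b i) tnth x l) =
  fun x => \sum_l (if b l == b i then tnth x l else 0)); last first.
  by apply/funext => x; exact: big_mkcond.
by apply: measurable_sum => l; case: (b l == b i) => //; exact: measurable_tnth.
Qed.

Lemma block_avg_const n (B : eqType) (b : 'I_n -> B) x i j : b i = b j ->
  tnth (block_avg b x) i = tnth (block_avg b x) j.
Proof. by move=> bij; rewrite !tnth_mktuple bij. Qed.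

(** On a block of length [K] with sum [S], where [th] has the value [v], the two sums of squares
    differ by exactly [K (S / K - v) ^ 2]. *)
Lemma sqdist_block_avg n (B : finType) (b : 'I_n -> B) (x th : n.-tuple R) :
  (forall i j, b i = b j -> tnth th i = tnth th j) ->
  sqdist x (block_avg b x) <= sqdist x th.
Proof.
move=> thb; rewrite /sqdist (partition_big b predT)//= [leRHS](partition_big b predT)//=.
apply: ler_sum => j _.
have [i0 /eqP bi0|nob] := pickP (fun i => b i == j); last first.
  by rewrite !big_pred0.
set K := #|[pred l | b l == b i0]|%:R : R; set S := \sum_(l | b l == b i0) tnth x l.
have K0 : 0 < K.
  by rewrite ltr0n; apply/card_gt0P; exists i0; rewrite inE.
rewrite -subr_ge0 -sumrB -bi0.
rewrite (eq_bigr (fun i => (S / K - tnth th i0) * (2 * tnth x i - S / K - tnth th i0))).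
  rewrite -mulr_sumr !sumrB -mulr_sumr -/S !sumr_const -/K.
  rewrite -[X in _ - X - _]mulr_natr -[X in _ - _ - X]mulr_natr.
  rewrite -!/K (_ : 2 * S - S / K * K - tnth th i0 * K = (S / K - tnth th i0) * K).
    by rewrite mulrA mulr_ge0 ?(ltW K0)// -expr2 sqr_ge0.
  by field; rewrite gt_eqF.
move=> i /eqP bi; rewrite tnth_mktuple bi -/S -/K (thb i i0 bi); ring.
Qed.

(** On each block this is the constant unit vector, so a weighted noise sum is a coefficient of the
    projection. *)
Definition block_weight n (B : finType) (b : 'I_n -> B) (i : 'I_n) : R :=
  (Num.sqrt #|[pred l | b l == b i]|%:R)^-1.

Lemma block_weight_norm n (B : finType) (b : 'I_n -> B) j :
  \sum_(i | b i == j) block_weight b i ^+ 2 <= 1.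
Proof.
rewrite (eq_bigr (fun i => (#|[pred l | b l == j]|%:R)^-1)); last first.
  by move=> i /eqP bi; rewrite /block_weight exprVn sqr_sqrtr ?ler0n// bi.
rewrite sumr_const -[leLHS]mulr_natl.
have [->|K0] := posnP #|[pred l | b l == j]|; first by rewrite mul0r.
by rewrite divff// pnatr_eq0 -lt0n.
Qed.

(* For [x = th + sigma * noise], the squared norm of the projection of the noise
   onto the vectors that are constant on the level sets of [b]. *)
Definition noise_energy (sigma : R) n (B : finType) (b : 'I_n -> B)
    (th x : n.-tuple R) : R :=
  \sum_j (\sum_(i | b i == j) block_weight b i * ((tnth x i - tnth th i) / sigma)) ^+ 2.

(* [2 u S <= K u^2 / 2 + 2 S^2 / K] on each block, where [u] is the constant
   value of [y - th], [S] the noise sum and [K] the length of the block. *)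
Lemma basic_inequality (sigma : R) n (B : finType) (b : 'I_n -> B)
    (x y th : n.-tuple R) : 0 < sigma ->
  (forall i j, b i = b j -> tnth y i - tnth th i = tnth y j - tnth th j) ->
  sqdist x y <= sqdist x th ->
  sqdist y th <= 4 * sigma ^+ 2 * noise_energy sigma b th x.
Proof.
move=> sigma0 ub xy.
pose u i := tnth y i - tnth th i; pose e i := tnth x i - tnth th i.
have h1 : sqdist y th <= 2 * \sum_i e i * u i.
  rewrite -subr_ge0; move: xy; rewrite -subr_ge0 => /le_trans; apply.
  rewrite /sqdist mulr_sumr -!sumrB le_eqVlt; apply/orP; left; apply/eqP.
  by apply: eq_bigr => i _; rewrite /e /u; ring.
have h2 : 2 * \sum_i e i * u i <= sqdist y th / 2 +
    2 * (sigma ^+ 2 * noise_energy sigma b th x).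
  rewrite /noise_energy /sqdist (partition_big b predT)//=.
  rewrite [X in _ <= X / 2 + _](partition_big b predT)//=.
  rewrite mulr_suml !mulr_sumr -big_split; apply: ler_sum => j _ /=.
  have [i0 /eqP bi0|nob] := pickP (fun i => b i == j); last first.
    by rewrite !big_pred0// mul0r mulr0 expr0n !mulr0 addr0.
  set K := #|[pred l | b l == b i0]|%:R : R.
  have K0 : 0 < K.
    by rewrite ltr0n; apply/card_gt0P; exists i0; rewrite inE.
  have uE i : b i == j -> u i = u i0 by move=> /eqP bi; apply: ub; rewrite bi bi0.
  rewrite (eq_bigr (fun i => e i * u i0)); last by move=> i /uE ->.
  rewrite [X in _ <= X / 2 + _](eq_bigr (fun i => u i0 ^+ 2)); last first.
    by move=> i /uE; rewrite /u => ->.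
  rewrite [X in _ <= _ + 2 * (_ * X ^+ 2)](eq_bigr
    (fun i => e i * ((Num.sqrt K)^-1 / sigma))); last first.
    by move=> i /eqP bi; rewrite /block_weight bi -bi0 -/K /e; ring.
  rewrite -!mulr_suml sumr_const -bi0 -[_ *+ _]mulr_natr -/K.
  set S := \sum_(i | _) e i.
  have rK : Num.sqrt K ^+ 2 = K by rewrite sqr_sqrtr// ltW.
  rewrite !exprMn !exprVn rK -subr_ge0.
  rewrite (_ : _ - _ = (K * u i0 - 2 * S) ^+ 2 / (2 * K)).
    by rewrite divr_ge0 ?sqr_ge0// mulr_ge0// ltW.
  by field; rewrite !gt_eqF.
by lra.
Qed.

End projection.

Section expectation_bound.
Variables (R : realType) (sigma : R) (n : nat) (theta : n.-tuple R).
Local Notation E := (@gauss_expect R sigma n theta).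

(** Measurability and nonnegativity are bundled with the bound because linearity and monotonicity of
    [gauss_expect] require them. *)
Definition mean_le (f : n.-tuple R -> R) (D : R) : Prop :=
  [/\ measurable_fun setT f, (forall x, 0 <= f x) & (E (fun x => (f x)%:E) <= D%:E)%E].

Lemma mean_le_cst (c : R) : 0 <= c -> mean_le (fun=> c) c.
Proof. by move=> c0; split => //; rewrite gauss_expect_cst. Qed.

Lemma mean_leD f g D D' : mean_le f D -> mean_le g D' ->
  mean_le (fun x => f x + g x) (D + D').
Proof.
move=> [mf f0 fD] [mg g0 gD]; split.
- exact: measurable_funD.
- by move=> x; rewrite addr_ge0.
- rewrite EFinD; apply: le_trans (leeD fD gD).
  by rewrite -gauss_expectD//; do ?[exact/measurable_EFinP|move=> y; rewrite lee_fin].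
Qed.

Lemma mean_leZ f D (c : R) : 0 <= c -> mean_le f D ->
  mean_le (fun x => c * f x) (c * D).
Proof.
move=> c0 [mf f0 fD]; split.
- exact: measurable_funM.
- by move=> x; rewrite mulr_ge0.
- rewrite EFinM; apply: (@le_trans _ _ (c%:E * E (fun x => (f x)%:E))%E).
    by rewrite -gauss_expectZ//; exact/measurable_EFinP.
  by apply: lee_wpmul2l; rewrite ?lee_fin.
Qed.

Lemma mean_le_sum (I : Type) (s : seq I) (f : I -> n.-tuple R -> R) (D : I -> R) :
  (forall i, mean_le (f i) (D i)) ->
  mean_le (fun x => \sum_(i <- s) f i x) (\sum_(i <- s) D i).
Proof.
move=> fD; elim: s => [|i s IH].
  rewrite big_nil (_ : (fun=> _) = fun=> 0); first exact: mean_le_cst.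
  by apply/funext => x; rewrite big_nil.
rewrite big_cons (_ : (fun=> _) = fun x => f i x + \sum_(j <- s) f j x).
  exact: mean_leD.
by apply/funext => x; rewrite big_cons.
Qed.

Lemma mean_le_weaken f D D' : D <= D' -> mean_le f D -> mean_le f D'.
Proof. by move=> DD' [mf f0 fD]; split=> //; rewrite (le_trans fD)// lee_fin. Qed.

End expectation_bound.

Section oracle.
Variables (R : realType) (sigma : R).
Hypothesis sigma0 : 0 < sigma.

(* The labels are monotone, so the sum [lab a i + lab a0 i] determines both of
   them: its level sets are the common refinement of the two partitions. *)
Lemma minimax_le_oracle n k M (I : eqType) (s : seq I) (lab : I -> 'I_n -> nat) (D : R) :
  (forall a (i j : 'I_n), a \in s -> (i <= j)%N -> (lab a i <= lab a j)%N) ->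
  (forall a i, a \in s -> (lab a i <= M)%N) -> s != [::] ->
  (forall th, @Theta R n k th -> exists2 a, a \in s &
     forall i j, lab a i = lab a j -> tnth th i = tnth th j) ->
  (forall th a0, a0 \in s -> exists2 H, mean_le sigma th H D &
     forall x a, a \in s -> noise_energy sigma
       (fun i => inord (lab a i + lab a0 i) : 'I_(M + M).+1) th x <= H x) ->
  (minimax_risk sigma n k <= (4 * sigma ^+ 2 * D)%:E)%E.
Proof.
move=> mono labM s0 Ths HD.
have mcost (f : n.-tuple R -> n.-tuple R) : measurable_fun setT f ->
    measurable_fun setT (fun x => sqdist x (f x)).
  by move=> mf; exact: measurable_sqdist.
have [est [mest ests estmin]] := measurable_argmin s0
  (fun a => @measurable_block_avg R n _ (lab a)) mcost.
apply: (@le_trans _ _ (ereal_sup [set risk sigma est th | th in @Theta R n k])).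
  by apply: ereal_inf_lbound; exists est.
apply: ge_ereal_sup => _ [th thT <-].
have [a0 a0s thE] := Ths th thT.
have [H mH HE] := HD th a0 a0s.
have c0 : 0 <= 4 * sigma ^+ 2 by rewrite mulr_ge0// sqr_ge0.
have [mH' H0 EH] := mean_leZ c0 mH.
apply: le_trans EH; apply: gauss_expect_le.
- exact: measurable_loss.
- exact/measurable_EFinP.
- by move=> x; rewrite lee_fin sqdist_ge0.
move=> x; rewrite lee_fin; have [a as_ estE] := ests x.
apply: le_trans (ler_wpM2l c0 (HE x a as_)).
apply: basic_inequality => //.
- move=> i j /(congr1 val) /=.
  rewrite !inordK ?ltnS ?leq_add ?labM//.
  have [ij|/ltnW ij] := leqP i j.
    have := mono _ _ _ as_ ij; have := mono _ _ _ a0s ij => h1 h2 e.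
    by rewrite (thE i j) ?estE ?(@block_avg_const _ _ _ (lab a) _ i j)//; lia.
  have := mono _ _ _ as_ ij; have := mono _ _ _ a0s ij => h1 h2 e.
  by rewrite (thE i j) ?estE ?(@block_avg_const _ _ _ (lab a) _ i j)//; lia.
- apply: le_trans (estmin x a0 a0s) _.
  (* [sqdist_block_avg] needs labels in a finite type; [inord] is faithful on labels up to [M]. *)
  pose b i : 'I_M.+1 := inord (lab a0 i).
  rewrite (_ : block_avg (lab a0) x = block_avg b x).
    apply: sqdist_block_avg => i j /(congr1 val) /=.
    by rewrite !inordK ?ltnS ?labM//; exact: thE.
  have bE i l : (lab a0 l == lab a0 i) = (b l == b i).
    by rewrite -val_eqE /= !inordK ?ltnS ?labM.
  apply: eq_from_tnth => i; rewrite !tnth_mktuple; congr (_ / _%:R).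
    exact: eq_bigl.
  by apply: eq_card => l; rewrite !inE.
Qed.

End oracle.

(** * Upper bounds by a union over partitions *)

Section union_bound.
Variables (R : realType) (sigma : R).
Hypothesis sigma0 : 0 < sigma.

(** [ln y <= y - 1] at [y = expR (z / 4) / A]. It bounds a maximum by a sum of exponentials: [A]
    offsets the mean of the sum at the price [ln A]. *)
Lemma le_softmax (A z : R) : 0 < A -> z <= 4 * (ln A + A^-1 * expR (4^-1 * z)).
Proof.
move=> A0; have e0 := expR_gt0 (4^-1 * z).
have := @ln_le_subr1 R (A^-1 * expR (4^-1 * z)).
rewrite mulr_gt0 ?invr_gt0// => /(_ isT).
rewrite lnM ?posrE ?invr_gt0// lnV ?posrE// expRK; lra.
Qed.

Lemma mean_le_exp_noise n (th : n.-tuple R) (B : finType) (b : 'I_n -> B) :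
  mean_le sigma th (fun x => expR (4^-1 * noise_energy sigma b th x)) (2 ^+ #|B|).
Proof.
split.
- apply: measurableT_comp => //; apply: measurable_funM => //.
  apply: measurable_sum => j; apply: measurable_funX.
  rewrite (_ : (fun x : n.-tuple R => _) = fun x => \sum_i (if b i == j then
    block_weight R b i * ((tnth x i - tnth th i) / sigma) else 0)); last first.
    by apply/funext => x; exact: big_mkcond.
  apply: measurable_sum => i; case: (b i == j) => //.
  apply: measurable_funM => //; apply: measurable_funM => //.
  by apply: measurable_funB => //; exact: measurable_tnth.
- by move=> x; exact: expR_ge0.
- by apply: gauss_expect_exp_sq_le => // j; exact: block_weight_norm.
Qed.

(** [A] is the number of partitions times the exponential moment bound for a refinement with
    [2 M + 1] labels, so the normalised sum of exponentials has mean at most 1. *)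
Lemma minimax_le_union n k M (I : eqType) (s : seq I) (lab : I -> 'I_n -> nat) :
  (forall a (i j : 'I_n), a \in s -> (i <= j)%N -> (lab a i <= lab a j)%N) ->
  (forall a i, a \in s -> (lab a i <= M)%N) -> s != [::] ->
  (forall th, @Theta R n k th -> exists2 a, a \in s &
     forall i j, lab a i = lab a j -> tnth th i = tnth th j) ->
  (minimax_risk sigma n k <=
    (16 * sigma ^+ 2 * (ln (size s)%:R + (M + M).+1%:R * ln 2 + 1))%:E)%E.
Proof.
move=> mono labM s0 Ths.
have sz0 : 0 < (size s)%:R :> R by rewrite ltr0n; case: (s) s0.
pose A : R := (size s)%:R * 2 ^+ (M + M).+1.
have A0 : 0 < A by rewrite mulr_gt0// exprn_gt0.
have lnA : ln A = ln (size s)%:R + (M + M).+1%:R * ln 2.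
  by rewrite lnM ?posrE ?exprn_gt0// lnX_natr.
have lnA0 : 0 <= ln A.
  by rewrite ln_ge0// -[leLHS]mulr1 ler_pM// ?exprn_ege1 ?ler1n// -(ltr0n R).
rewrite (_ : 16 * _ * _ = 4 * sigma ^+ 2 * (4 * (ln A + A^-1 *
   (\sum_(a <- s) 2 ^+ (M + M).+1)))); last first.
  rewrite big_const_seq count_predT iter_addr_0 -[2 ^+ _ *+ _]mulr_natl -/A mulVf ?gt_eqF//.
  by rewrite lnA; ring.
apply: (@minimax_le_oracle R sigma sigma0 n k M I s lab) => // th a0 a0s.
pose c a (i : 'I_n) : 'I_(M + M).+1 := inord (lab a i + lab a0 i).
exists (fun x => 4 * (ln A + A^-1 *
    \sum_(a <- s) expR (4^-1 * noise_energy sigma (c a) th x))).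
  apply: mean_leZ => //; apply: mean_leD; first exact: mean_le_cst.
  apply: mean_leZ; first by rewrite invr_ge0 ltW.
  apply: mean_le_sum => a.
  by have := mean_le_exp_noise th (c a); rewrite card_ord.
move=> x a as_; apply: le_trans (le_softmax _ A0) _.
rewrite ler_wpM2l// lerD2l ler_wpM2l ?invr_ge0 ?(ltW A0)//.
rewrite (big_rem a as_)/= lerDl sumr_ge0// => *; exact: expR_ge0.
Qed.

Lemma minimax_upper_one n : (0 < n)%N ->
  (minimax_risk sigma n 1 <= (32 * sigma ^+ 2)%:E)%E.
Proof.
move=> n0; have := @minimax_le_union n 1 0 unit [:: tt] (fun _ _ => 0%N).
move=> /(_ (fun _ _ _ _ _ => leqnn 0) (fun _ _ _ => leqnn 0) isT) => /(_ _)/le_trans; apply.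
  move=> th [a [mu [a0 a1 _ thE]]]; exists tt; rewrite ?inE// => i j _.
  by rewrite !(thE _ 1%N)//= a0 a1 ltn_ord.
rewrite lee_fin /= ln1.
have := ln2_le1 R.
by have := sqr_ge0 sigma; nra.
Qed.

(** * Partitions encoded by jump sets *)

Section many.
Local Close Scope classical_set_scope.
Local Open Scope set_scope.

(* [t \in T] stands for a possible jump between the coordinates [t - 1] and [t]. *)
Definition jump_label n (T : {set 'I_n}) (i : 'I_n) : nat := #|[set t in T | (t <= i)%N]|.

Lemma jump_label_mono n (T : {set 'I_n}) (i j : 'I_n) :
  (i <= j)%N -> (jump_label T i <= jump_label T j)%N.
Proof.
move=> ij; apply/subset_leq_card/fintype.subsetP => t; rewrite !inE.
by move=> /andP[-> /leq_trans]; exact.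
Qed.

Lemma jump_label_le n (T : {set 'I_n}) i : (jump_label T i <= #|T|)%N.
Proof. by apply/subset_leq_card/fintype.subsetP => t; rewrite !inE => /andP[]. Qed.

Lemma jump_label_lt n (T : {set 'I_n}) (i j t : 'I_n) : t \in T ->
  (i < t <= j)%N -> (jump_label T i < jump_label T j)%N.
Proof.
move=> tT /andP[it tj]; apply/proper_card/fintype.properP; split.
  by apply/fintype.subsetP => u; rewrite !inE => /andP[-> /= ui]; lia.
by exists t; rewrite !inE ?tT//= -ltnNge.
Qed.

Lemma Theta_jumps n k (th : n.-tuple R) : @Theta R n k th ->
  exists2 T : {set 'I_n}, (#|T| <= k)%N &
    forall i j, jump_label T i = jump_label T j -> tnth th i = tnth th j.
Proof.
move=> [a [mu [a0 ak amono thE]]].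
(* The breakpoints [a 0, ..., a (k - 1)]; [insub] discards those equal to [n]. *)
pose T := [set i : 'I_n | i \in (pmap insub [seq a j | j <- iota 0 k] : seq 'I_n)].
exists T.
  rewrite cardsE (leq_trans (card_size _))// size_pmap (leq_trans (count_size _ _))//.
  by rewrite size_map size_iota.
have wlg (i l : 'I_n) : (i <= l)%N -> jump_label T i = jump_label T l ->
    tnth th i = tnth th l.
  move=> il e.
  have exj : exists j, (i < a j)%N by exists k; rewrite ak.
  (* By minimality [j] is the piece of [i]. If [l] were beyond it, [a j] would be a jump between [i]
     and [l], and their labels would differ. *)
  case: (ex_minnP exj) => j iaj minj.
  have jk : (j <= k)%N by apply: minj; rewrite ak.
  have j0 : (0 < j)%N by case: j iaj {minj jk} => //; rewrite a0.
  have aj1 : (a j.-1 <= i)%N by rewrite leqNgt; apply/negP => /minj; lia.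
  have laj : (l < a j)%N.
    rewrite ltnNge; apply/negP => ajl.
    have ajn : (a j < n)%N by apply: leq_ltn_trans (ltn_ord l).
    have jk' : (j < k)%N.
      by rewrite ltn_neqAle jk andbT; apply: contraTN ajn => /eqP->; rewrite ak ltnn.
    have ajT : Ordinal ajn \in T.
      rewrite inE mem_pmap; apply/mapP; exists (a j).
        by apply/mapP; exists j; rewrite // mem_iota.
      by rewrite (insubT (fun x => x < n)%N ajn).
    have := @jump_label_lt _ T i l _ ajT; rewrite /= iaj ajl e ltnn => /(_ isT).
    by [].
  rewrite !(thE _ j) ?j0 ?jk//; lia.
move=> i l e; have [il|/ltnW li] := leqP i l; first exact: wlg.
by apply/esym/wlg.
Qed.

(* Markov's trick: [1 <= x ^ (#|T| - k)] for [x = k / n], and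
   [\sum_T x ^ #|T| = (1 + x) ^ n <= e ^ k]. *)
Lemma card_small_sets n k : (0 < k <= n)%N ->
  ln #|[set T : {set 'I_n} | (#|T| <= k)%N]|%:R <=
    k%:R * ln (expR 1 * n%:R / k%:R) :> R.
Proof.
move=> /andP[k0 kn].
have k0R : 0 < k%:R :> R by rewrite ltr0n.
have n0R : 0 < n%:R :> R by rewrite ltr0n; lia.
pose x : R := k%:R / n%:R.
have x0 : 0 < x by rewrite divr_gt0.
have x1 : x <= 1 by rewrite ler_pdivrMr// mul1r ler_nat.
have sumx : \sum_(T : {set 'I_n}) x ^+ #|T| <= expR k%:R.
  have -> : \sum_(T : {set 'I_n}) x ^+ #|T| = (x + 1) ^+ n.
    rewrite -[n in RHS]card_ord -prodr_const bigA_distr/=; apply: eq_bigr => T _.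
    rewrite (bigID (mem T))/= [X in _ * X]big1 ?mulr1; last by move=> i /negbTE->.
    by rewrite (eq_bigr (fun=> x)) ?prodr_const// => i ->.
  rewrite (_ : k%:R = x * n%:R); last by rewrite /x divfK// gt_eqF.
  rewrite expRM_natr lerXn2r ?nnegrE ?expR_ge0 ?addr_ge0 ?(ltW x0)//.
  by rewrite addrC expR_ge1Dx.
set N := #|_|.
have N0 : 0 < N%:R :> R.
  by rewrite ltr0n; apply/card_gt0P; exists finset.set0; rewrite inE cards0.
rewrite -lnX_natr ?divr_gt0 ?mulr_gt0 ?expR_gt0//.
rewrite ler_ln ?posrE ?exprn_gt0 ?divr_gt0 ?mulr_gt0 ?expR_gt0//.
rewrite (_ : expR 1 * n%:R / k%:R = expR 1 * x^-1); last by rewrite /x invf_div mulrA.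
rewrite exprMn -expRM_natr mul1r exprVn ler_pdivlMr ?exprn_gt0//.
apply: le_trans sumx; rewrite /N -sum1_card natr_sum mulr_suml.
rewrite [leLHS]big_mkcond; apply: ler_sum => T _ /=; rewrite inE.
case: ifP => [Tk|_]; last by rewrite exprn_ge0// ltW.
by rewrite mul1r; apply: ler_wiXn2l => //; exact: ltW.
Qed.

Lemma minimax_upper_many n k : (0 < k <= n)%N ->
  (minimax_risk sigma n k <=
     (80 * (sigma ^+ 2 * k%:R * ln (expR 1 * n%:R / k%:R)))%:E)%E.
Proof.
move=> kn; have /andP[k0 kn'] := kn.
pose s := enum [set T : {set 'I_n} | (#|T| <= k)%N].
have sP T : (T \in s) = (#|T| <= k)%N by rewrite mem_enum inE.
apply: le_trans (@minimax_le_union n k k _ s (@jump_label n) _ _ _ _) _.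
- by move=> T i j _; exact: jump_label_mono.
- by move=> T i; rewrite sP; exact: leq_trans (jump_label_le _ _).
- apply/eqP => s0; have := sP finset.set0; rewrite s0 cards0 leq0n in_nil.
  by [].
- by move=> th /Theta_jumps[T Tk thT]; exists T; rewrite ?sP.
have szs : size s = #|[set T : {set 'I_n} | (#|T| <= k)%N]| by rewrite /s -cardE.
rewrite lee_fin.
have k0R : 1 <= k%:R :> R by rewrite ler1n.
have n0R : 0 < n%:R :> R by rewrite ltr0n; lia.
have l2 := ln2_le1 R.
have l20 := ln2_ge_half R.
have Nl : ln (size s)%:R <= k%:R * ln (expR 1 * n%:R / k%:R) :> R.
  by rewrite szs; exact: card_small_sets.
have l1 : 1 <= ln (expR 1 * n%:R / k%:R) :> R.
  have k0R' : 0 < k%:R :> R by rewrite ltr0n.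
  rewrite -[leLHS](@expRK R) ler_ln ?posrE ?divr_gt0 ?mulr_gt0 ?expR_gt0//.
  by rewrite ler_pdivlMr// ler_wpM2l ?expR_ge0// ler_nat.
move: (ln (expR 1 * _ / _)) (ln (size s)%:R) Nl l1 => l N Nl l1.
rewrite -[X in X <= _]mulrA -[_ * k%:R * _]mulrA [leRHS]mulrCA [leLHS]mulrCA.
rewrite ler_wpM2l ?sqr_ge0//.
(* The three terms are at most [k l], [3 k l] and [k l]; this is where [80 = 16 * 5] comes from. *)
have : (k + k).+1%:R * ln 2 <= 3 * k%:R :> R.
  by rewrite -addn1 !natrD; nra.
by nra.
Qed.

End many.

End union_bound.

(** * Chaining and the two-piece upper bound *)

Section dyadic_chain.
Variables (R : realType) (S : nat -> R).

Lemma sum_geometric D : \sum_(d < D) (2 / 3 : R) ^+ d <= 3.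
Proof.
rewrite (_ : \sum_(d < D) (2 / 3) ^+ d = 3 - 3 * (2 / 3) ^+ D :> R); last first.
  by elim: D => [|D IH]; rewrite ?big_ord0 ?big_ord_recr/= ?IH ?expr0 ?exprS; field.
by rewrite lerBlDr lerDl mulr_ge0// exprn_ge0.
Qed.

Lemma sum_arith_geometric D : \sum_(d < D) d%:R * (2 / 3 : R) ^+ d <= 6.
Proof.
rewrite (_ : \sum_(d < D) d%:R * (2 / 3) ^+ d = 6 - (3 * D%:R + 6) * (2 / 3) ^+ D :> R).
  by rewrite lerBlDr lerDl mulr_ge0 ?exprn_ge0// addr_ge0// mulr_ge0.
elim: D => [|D IH]; first by rewrite big_ord0 expr0; ring.
by rewrite big_ord_recr/= IH exprS -natr1; field.
Qed.

Definition dyadic_trunc m l := (m %/ 2 ^ l * 2 ^ l)%N.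
(** The increment over the left half of the [q]-th dyadic interval of length [2 ^ (l + 1)]; right
    halves never occur when [m] is built up from its leading binary digits. *)
Definition dyadic_incr l q := S (q.*2.+1 * 2 ^ l)%N - S (q.*2 * 2 ^ l)%N.

(** The truncations differ by the binary digit [l] of [m]: they coincide if it is 0 and are one
    increment apart if it is 1. *)
Lemma dyadic_step m l :
  (S (dyadic_trunc m l) - S (dyadic_trunc m l.+1)) ^+ 2 <=
    dyadic_incr l (m %/ 2 ^ l.+1) ^+ 2.
Proof.
rewrite /dyadic_trunc expnSr divnMA; set u := (m %/ 2 ^ l)%N.
have -> : (u %/ 2 * (2 ^ l * 2) = (u %/ 2).*2 * 2 ^ l)%N.
  by rewrite -muln2 -mulnA [(2 ^ l * 2)%N]mulnC.
have [e|e] : u = (u %/ 2).*2 \/ u = (u %/ 2).*2.+1 by lia.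
  by rewrite -e subrr expr0n sqr_ge0.
by rewrite /dyadic_incr -e.
Qed.

(* [(a + b)^2 <= 4/3 a^2 + 4 b^2], with [b] the increment at the coarser scale,
   so that the factor 4/3 only accumulates on the finer scales. *)
Lemma dyadic_chain m l : (S m - S (dyadic_trunc m l)) ^+ 2 <=
  4 * \sum_(i < l) (4 / 3) ^+ (l.-1 - i) * dyadic_incr i (m %/ 2 ^ i.+1) ^+ 2.
Proof.
elim: l => [|l IH].
  by rewrite /dyadic_trunc expn0 divn1 muln1 subrr expr0n big_ord0 mulr0.
rewrite big_ord_recr/= subnn expr0 mul1r.
have -> : \sum_(i < l) (4 / 3) ^+ (l - i) * dyadic_incr i (m %/ 2 ^ i.+1) ^+ 2 =
    4 / 3 * \sum_(i < l) (4 / 3) ^+ (l.-1 - i) * dyadic_incr i (m %/ 2 ^ i.+1) ^+ 2.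
  rewrite mulr_sumr; apply: eq_bigr => i _; rewrite mulrA -exprS; congr (_ ^+ _ * _).
  by have := ltn_ord i; lia.
have := dyadic_step m l; move: IH.
move: (S m) (S (dyadic_trunc m l)) (S (dyadic_trunc m l.+1)) => a b c.
move: (\sum_(i < l) _) (dyadic_incr l _ ^+ 2) => X Y.
have := sqr_ge0 ((a - b) - 3 * (b - c)).
rewrite (_ : a - c = (a - b) + (b - c)); last by ring.
move: (a - b) (b - c) => u v; rewrite !expr2; lra.
Qed.

(** Dividing by [m >= 2 ^ (j - i) * 2 ^ i] turns the growing weight [(4 / 3) ^ (j - i)] into the
    summable [(2 / 3) ^ (j - i)] and normalises each increment by its length. *)
Lemma dyadic_bound m j : S 0%N = 0 -> (2 ^ j <= m < 2 ^ j.+1)%N ->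
  S m ^+ 2 / m%:R <= 4 * \sum_(i < j.+1) (2 / 3) ^+ (j - i) *
    (dyadic_incr i (m %/ 2 ^ i.+1) ^+ 2 / 2 ^+ i).
Proof.
move=> S0 /andP[jm mj].
have := dyadic_chain m j.+1.
rewrite /dyadic_trunc divn_small// mul0n S0 subr0 /= => h.
have m0 : 0 < m%:R :> R by rewrite ltr0n (leq_trans _ jm)// expn_gt0.
have p0 i : 0 < 2 ^+ i :> R by rewrite exprn_gt0.
apply: (@le_trans _ _ (S m ^+ 2 / 2 ^+ j)).
  by rewrite ler_wpM2l ?sqr_ge0// lef_pV2 ?posrE// -natrX ler_nat.
rewrite ler_pdivrMr//; apply: (le_trans h); rewrite -mulrA ler_wpM2l// mulr_suml.
apply: ler_sum => i _; rewrite le_eqVlt; apply/orP; left; apply/eqP.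
have ij : (i <= j)%N by have := ltn_ord i; lia.
have -> : 2 ^+ j = 2 ^+ (j - i) * 2 ^+ i :> R by rewrite -exprD subnK.
rewrite (_ : (4 / 3 : R) = 2 / 3 * 2); last by field.
by rewrite exprMn; field; rewrite gt_eqF.
Qed.

(* [le_softmax] with [A = J 2^d] at the scale [2^(j - d)], which carries [2^d]
   increments in the block [2^j <= m < 2^(j + 1)]. *)
Lemma chain_softmax m J : S 0%N = 0 -> (0 < m < 2 ^ J)%N ->
  S m ^+ 2 / m%:R <= (48 * ln J%:R + 96) + 16 * (J%:R^-1 * \sum_(j < J) \sum_(d < j.+1)
    (2 / 3) ^+ d * (2 ^- d * \sum_(q < 2 ^ d)
      expR (4^-1 * (dyadic_incr (j - d) q ^+ 2 / 2 ^+ (j - d))))).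
Proof.
move=> S0 /andP[m0 mJ].
pose j := trunc_log 2 m.
have /andP[jm mj] : (2 ^ j <= m < 2 ^ j.+1)%N by exact: trunc_log_bounds.
have jJ : (j < J)%N by rewrite -(ltn_exp2l _ _ (ltnSn 1)); exact: leq_ltn_trans mJ.
have J1 : 1 <= J%:R :> R by rewrite ler1n; lia.
have J0 : 0 < J%:R :> R by lra.
have lnJ0 : 0 <= ln J%:R :> R by rewrite ln_ge0.
have p0 i : 0 < 2 ^+ i :> R by rewrite exprn_gt0.
have x0 i : 0 <= (2 / 3) ^+ i :> R by rewrite exprn_ge0.
apply: le_trans (@dyadic_bound m j S0 _) _; first by rewrite jm mj.
pose Z d := \sum_(q < 2 ^ d)
      expR (4^-1 * (dyadic_incr (j - d) q ^+ 2 / 2 ^+ (j - d))).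
have l2 := ln2_le1 R.
apply: (@le_trans _ _ (4 * \sum_(d < j.+1) (2 / 3) ^+ d *
   (4 * ((ln J%:R + d%:R) + J%:R^-1 * (2 ^- d * Z d))))).
  rewrite ler_wpM2l// [leRHS](reindex_inj rev_ord_inj)/=.
  apply: ler_sum => i _; rewrite subSS ler_wpM2l//.
  have ij : (i <= j)%N by have := ltn_ord i; lia.
  have A0 : 0 < J%:R * 2 ^+ (j - i) :> R by rewrite mulr_gt0.
  apply: le_trans (le_softmax _ A0) _; rewrite ler_wpM2l// lerD//.
    rewrite lnM ?posrE// lnX_natr// lerD2l ler_piMr//.
  rewrite invfM -mulrA ler_wpM2l ?invr_ge0 ?(ltW J0)// ler_wpM2l ?invr_ge0 ?(ltW (p0 _))//.
  rewrite /Z subKn//.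
  have qb : (m %/ 2 ^ i.+1 < 2 ^ (j - i))%N.
    by rewrite ltn_divLR ?expn_gt0// -expnD addnS subnK.
  rewrite (bigD1 (Ordinal qb))//= lerDl sumr_ge0// => q _; exact: expR_ge0.
rewrite (eq_bigr (fun d : 'I_j.+1 => 4 * ln J%:R * (2 / 3) ^+ d + 4 * (d%:R * (2 / 3) ^+ d) +
    4 * J%:R^-1 * ((2 / 3) ^+ d * (2 ^- d * Z d)))); last by move=> d _; ring.
rewrite !big_split/= -!mulr_sumr.
(* The sums 3 and 6, times [4 * 4], give the constants 48 and 96. *)
have g1 := sum_geometric j.+1; have g2 := sum_arith_geometric j.+1.
have h1 : ln J%:R * \sum_(d < j.+1) (2 / 3) ^+ d <= 3 * ln J%:R :> R.
  by rewrite [leRHS]mulrC ler_wpM2l.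
have h2 : J%:R^-1 * \sum_(d < j.+1) (2 / 3) ^+ d * (2 ^- d * Z d) <=
    J%:R^-1 * \sum_(j < J) \sum_(d < j.+1)
    (2 / 3) ^+ d * (2 ^- d * \sum_(q < 2 ^ d)
      expR (4^-1 * (dyadic_incr (j - d) q ^+ 2 / 2 ^+ (j - d)))).
  rewrite ler_wpM2l ?invr_ge0 ?(ltW J0)// (bigD1 (Ordinal jJ))//= lerDl.
  apply: sumr_ge0 => j' _; apply: sumr_ge0 => d _.
  by rewrite !mulr_ge0 ?invr_ge0 ?(ltW (p0 _))// sumr_ge0// => q _; exact: expR_ge0.
by lra.
Qed.

End dyadic_chain.

Section chain_expectation.
Variables (R : realType) (sigma : R).
Hypothesis sigma0 : 0 < sigma.

(** The case of a single block in [gauss_expect_exp_sq_le]. [A] may have fewer than [l] elements, as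
    for an interval cut off at an end of the index range. *)
Lemma mean_le_exp_sum n (th : n.-tuple R) (A : pred 'I_n) (l : nat) : (0 < l)%N ->
  (#|A| <= l)%N ->
  mean_le sigma th (fun x => expR (4^-1 *
    ((\sum_(i | A i) (tnth x i - tnth th i) / sigma) ^+ 2 / l%:R))) 2.
Proof.
move=> l0 Al; have l0R : 0 < l%:R :> R by rewrite ltr0n.
pose w (i : 'I_n) : R := if A i then (Num.sqrt l%:R)^-1 else 0.
have rl : Num.sqrt l%:R ^+ 2 = l%:R :> R by rewrite sqr_sqrtr// ltW.
have wE x : (\sum_(i | A i) (tnth x i - tnth th i) / sigma) ^+ 2 / l%:R =
  \sum_(j : unit) (\sum_(i < n | tt == j) w i * ((tnth x i - tnth th i) / sigma)) ^+ 2.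
  rewrite (big_pred1 tt); last by case.
  rewrite [in RHS](bigID A)/= [X in (_ + X) ^+ 2]big1 ?addr0; last first.
    by move=> i /negbTE Ai; rewrite /w Ai mul0r.
  rewrite [X in _ = X ^+ 2](eq_bigr
    (fun i => (tnth x i - tnth th i) / sigma / Num.sqrt l%:R)); last first.
    by move=> i Ai; rewrite /w Ai mulrC.
  by rewrite -[in RHS]mulr_suml expr_div_n rl.
split.
- apply: measurableT_comp => //; apply: measurable_funM => //.
  apply: measurable_funM => //; apply: measurable_funX.
  rewrite (_ : (fun x : n.-tuple R => _) = fun x => \sum_i (if A i then
    ((tnth x i - tnth th i) / sigma) else 0)); last first.
    by apply/funext => x; exact: big_mkcond.
  apply: measurable_sum => i; case: (A i) => //.
  apply: measurable_funM => //.
  by apply: measurable_funB => //; exact: measurable_tnth.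
- by move=> x; exact: expR_ge0.
- under eq_fun do rewrite wE.
  have := @gauss_expect_exp_sq_le R sigma sigma0 n th unit (fun=> tt) w.
  rewrite card_unit expr1; apply => j.
  rewrite (eq_bigl xpredT); last by case: j.
  rewrite (bigID A)/= [X in _ + X]big1 ?addr0; last first.
    by move=> i /negbTE Ai; rewrite /w Ai expr0n.
  rewrite (eq_bigr (fun i => l%:R^-1)); last by move=> i Ai; rewrite /w Ai exprVn rl.
  by rewrite sumr_const -[leLHS]mulr_natr mulrC ler_pdivrMr// mul1r ler_nat.
Qed.

(** The right side of [chain_softmax] does not depend on [m] and serves as [H]. The partial sums are
    abstract, to cover sums running forwards and backwards. *)
Lemma maximal_chain n (th : n.-tuple R) (S : nat -> n.-tuple R -> R) J : (0 < J)%N ->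
  (forall x, S 0%N x = 0) ->
  (forall u v, (u <= v)%N -> exists2 A : pred 'I_n, (#|A| <= v - u)%N &
     forall x, S v x - S u x = \sum_(i | A i) (tnth x i - tnth th i) / sigma) ->
  exists2 H, mean_le sigma th H (48 * ln J%:R + 192) &
    forall x m, (0 < m < 2 ^ J)%N -> S m x ^+ 2 / m%:R <= H x.
Proof.
move=> J0 S0 incr.
have J1 : 1 <= J%:R :> R by rewrite ler1n.
have J0R : 0 < J%:R :> R by lra.
have lnJ0 : 0 <= ln J%:R :> R by rewrite ln_ge0.
pose Y x l q := dyadic_incr (S^~ x) l q ^+ 2 / 2 ^+ l.
exists (fun x => (48 * ln J%:R + 96) + 16 * (J%:R^-1 * \sum_(j < J) \sum_(d < j.+1)
    (2 / 3) ^+ d * (2 ^- d * \sum_(q < 2 ^ d) expR (4^-1 * Y x (j - d)%N q)))); last first.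
  by move=> x m mJ; exact: chain_softmax.
apply: (@mean_le_weaken _ _ _ _ _ ((48 * ln J%:R + 96) + 16 * (J%:R^-1 *
  \sum_(j < J) \sum_(d < j.+1) (2 / 3) ^+ d * (2 ^- d * \sum_(q < 2 ^ d) 2)))).
  (* Each exponential has mean at most 2 and the geometric sum is at most 3, while the averages over
     [q] and [j] cost nothing; [96 + 16 * 6 = 192]. *)
  have le6 : J%:R^-1 * (\sum_(j < J) \sum_(d < j.+1) (2 / 3) ^+ d *
      (2 ^- d * \sum_(q < 2 ^ d) 2)) <= 6 :> R.
    rewrite mulrC ler_pdivrMr// mulr_natr -[X in 6 *+ X]card_ord -sumr_const.
    apply: ler_sum => j _; rewrite (eq_bigr (fun d : 'I_j.+1 => (2 / 3) ^+ d * 2)).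
      by rewrite -mulr_suml; have := sum_geometric R j.+1; lra.
    move=> d _; have -> : \sum_(q < 2 ^ d) 2 = 2 ^+ d * 2 :> R.
      by rewrite sumr_const card_ord -natrX -[LHS]mulr_natl.
    by rewrite mulKf// gt_eqF// exprn_gt0.
  by lra.
apply: mean_leD; first by apply: mean_le_cst; rewrite addr_ge0// mulr_ge0.
apply: mean_leZ => //; apply: mean_leZ; first by rewrite invr_ge0 ltW.
apply: mean_le_sum => j; apply: mean_le_sum => d.
apply: mean_leZ; first by rewrite exprn_ge0.
apply: mean_leZ; first by rewrite invr_ge0 exprn_ge0.
apply: mean_le_sum => q; rewrite /Y /dyadic_incr.
set l := (j - d)%N.
have [|A cA AE] := incr (q.*2 * 2 ^ l)%N (q.*2.+1 * 2 ^ l)%N.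
  by rewrite leq_mul2r leqnSn orbT.
under eq_fun do rewrite AE -natrX.
apply: mean_le_exp_sum; first by rewrite expn_gt0.
by apply: leq_trans cA _; rewrite -mulnBl subSnn mul1n.
Qed.

End chain_expectation.

(** * Two pieces *)

Section two_pieces.
Variables (R : realType) (sigma : R).
Hypothesis sigma0 : 0 < sigma.

Definition noise_sum n (th x : n.-tuple R) (p q : nat) : R :=
  \sum_(i < n | (p <= i < q)%N) (tnth x i - tnth th i) / sigma.

Lemma noise_sum_cat n (th x : n.-tuple R) p q r : (p <= q <= r)%N ->
  noise_sum th x p r = noise_sum th x p q + noise_sum th x q r.
Proof.
move=> pqr; rewrite /noise_sum (bigID (fun i : 'I_n => (i < q)%N))/=.
by congr (_ + _); apply: eq_bigl => i; lia.
Qed.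

Lemma card_itv n p q : (p <= q <= n)%N -> #|[pred i : 'I_n | (p <= i < q)%N]| = (q - p)%N.
Proof.
move=> /andP[pq qn]; apply/eqP; rewrite -(eqr_nat R) -[X in _ == X]mulr1 -(@sum_ord_itv R n)//.
by rewrite -big_mkcond/= -sum1_card natr_sum.
Qed.

Lemma card_itv_le n p q : (#|[pred i : 'I_n | (p <= i < q)%N]| <= q - p)%N.
Proof.
rewrite (@eq_card _ _ [pred i : 'I_n | (minn p (minn q n) <= i < minn q n)%N]).
  by rewrite card_itv; lia.
by move=> i; rewrite !inE; have := ltn_ord i; lia.
Qed.

Lemma forward_maximal n (th : n.-tuple R) a J : (0 < J)%N ->
  exists2 H, mean_le sigma th H (48 * ln J%:R + 192) &
    forall x m, (0 < m < 2 ^ J)%N -> noise_sum th x a (a + m) ^+ 2 / m%:R <= H x.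
Proof.
move=> J0; apply: (@maximal_chain R sigma sigma0 n th (fun m x => noise_sum th x a (a + m))) => //.
  by move=> x; rewrite /noise_sum big_pred0// => i; lia.
move=> u v uv; exists [pred i : 'I_n | (a + u <= i < a + v)%N].
  by apply: leq_trans (card_itv_le _ _ _) _; lia.
by move=> x; rewrite (@noise_sum_cat _ _ _ a (a + u) (a + v)) 1?addrAC ?subrr ?add0r//; lia.
Qed.

(** Truncated subtraction stops the sum at index 0 once [m] exceeds [b]; increments then have fewer
    than [v - u] terms, which [maximal_chain] permits. *)
Lemma backward_maximal n (th : n.-tuple R) b J : (0 < J)%N ->
  exists2 H, mean_le sigma th H (48 * ln J%:R + 192) &
    forall x m, (0 < m < 2 ^ J)%N -> noise_sum th x (b - m) b ^+ 2 / m%:R <= H x.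
Proof.
move=> J0; apply: (@maximal_chain R sigma sigma0 n th (fun m x => noise_sum th x (b - m) b)) => //.
  by move=> x; rewrite /noise_sum big_pred0// => i; lia.
move=> u v uv; exists [pred i : 'I_n | (b - v <= i < b - u)%N].
  by apply: leq_trans (card_itv_le _ _ _) _; lia.
by move=> x; rewrite (@noise_sum_cat _ _ _ (b - v) (b - u) b) ?addrK//; lia.
Qed.

Lemma block_energy_itv n (th x : n.-tuple R) (B : finType) (b : 'I_n -> B) j p q :
  (p <= q <= n)%N -> (forall i, (b i == j) = (p <= i < q)%N) ->
  (\sum_(i | b i == j) block_weight R b i * ((tnth x i - tnth th i) / sigma)) ^+ 2 =
  noise_sum th x p q ^+ 2 / (q - p)%:R.
Proof.
move=> pqn bE.
rewrite (eq_bigr (fun i => (tnth x i - tnth th i) / sigma * (Num.sqrt (q - p)%:R)^-1)).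
  rewrite -mulr_suml exprMn exprVn sqr_sqrtr ?ler0n//; congr (_ ^+ 2 / _).
  exact: eq_bigl.
move=> i /eqP bi; rewrite mulrC /block_weight bi; congr (_ / Num.sqrt _%:R).
by rewrite -(card_itv pqn); apply: eq_card => l; rewrite !inE.
Qed.

(* Each block is an interval with an endpoint among [0], [t0] and [n], which is why
   maxima over a single endpoint, hence an iterated logarithm, suffice. *)
Lemma noise_energy_two n (th : n.-tuple R) J (t0 : 'I_n) : (n < 2 ^ J)%N -> (0 < J)%N ->
  exists2 H, mean_le sigma th H (4 * (48 * ln J%:R + 192)) &
    forall x (t : 'I_n), noise_energy sigma
      (fun i => inord ((t <= i)%N + (t0 <= i)%N) : 'I_(1 + 1).+1) th x <= H x.
Proof.
move=> nJ J0.
have [H1 H1m H1le] := forward_maximal th 0 J0.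
have [H2 H2m H2le] := backward_maximal th n J0.
have [H3 H3m H3le] := forward_maximal th t0 J0.
have [H4 H4m H4le] := backward_maximal th t0 J0.
exists (fun x => (H1 x + H2 x) + (H3 x + H4 x)).
  apply: mean_le_weaken (mean_leD (mean_leD H1m H2m) (mean_leD H3m H4m)).
  by lra.
move=> x t; rewrite /noise_energy; set c := fun i : 'I_n => _.
have tn := ltn_ord t; have t0n := ltn_ord t0.
(* Label 0 marks the coordinates before both jumps, 1 those between them, 2 those after both. *)
have cE i k (k3 : (k < 3)%N) : (c i == Ordinal k3) = ((t <= i)%N + (t0 <= i)%N == k)%N.
  by rewrite -val_eqE /= inordK//; case: (t <= i)%N; case: (t0 <= i)%N.
rewrite !big_ord_recl big_ord0 addr0.
have -> : lift ord0 (lift ord0 ord0) = Ordinal (isT : 2 < 3)%N :> 'I_3 by exact: val_inj.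
have -> : lift ord0 ord0 = Ordinal (isT : 1 < 3)%N :> 'I_3 by exact: val_inj.
have -> : ord0 = Ordinal (isT : 0 < 3)%N :> 'I_3 by exact: val_inj.
have h1 : (\sum_(i | c i == Ordinal (isT : 0 < 3)%N)
    block_weight R c i * ((tnth x i - tnth th i) / sigma)) ^+ 2 <= H1 x.
  rewrite (@block_energy_itv _ _ _ _ _ _ 0 (minn t t0)); first last.
  - by move=> i; rewrite cE; lia.
  - by lia.
  (* For an empty block the division by zero yields 0. *)
  have [->|m0] := posnP (minn t t0); first by rewrite subnn invr0 mulr0; case: H1m.
  by rewrite subn0 -{1}[minn t t0]add0n H1le//; lia.
have h2 : (\sum_(i | c i == Ordinal (isT : 2 < 3)%N)
    block_weight R c i * ((tnth x i - tnth th i) / sigma)) ^+ 2 <= H2 x.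
  rewrite (@block_energy_itv _ _ _ _ _ _ (maxn t t0) n); first last.
  - by move=> i; rewrite cE; have := ltn_ord i; lia.
  - by lia.
  by rewrite -{1}(@subKn (maxn t t0) n) ?H2le//; lia.
have h3 : (\sum_(i | c i == Ordinal (isT : 1 < 3)%N)
    block_weight R c i * ((tnth x i - tnth th i) / sigma)) ^+ 2 <= H3 x + H4 x.
  rewrite (@block_energy_itv _ _ _ _ _ _ (minn t t0) (maxn t t0)); first last.
  - by move=> i; rewrite cE; lia.
  - by lia.
  have H30 : 0 <= H3 x by case: H3m.
  have H40 : 0 <= H4 x by case: H4m.
  (* The middle block ends at [t0] in the first case and starts there in the second. *)
  have [tt0|tt0|tt0] := ltngtP t t0.
  - apply: le_trans (_ : H4 x <= _); last by rewrite lerDr.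
    by rewrite -{1}(@subKn t t0) ?H4le//; lia.
  - apply: le_trans (_ : H3 x <= _); last by rewrite lerDl.
    by rewrite -{1}(@subnKC t0 t) ?H3le//; lia.
  - by rewrite tt0 subnn invr0 mulr0 addr_ge0.
by lra.
Qed.

(** The jump is at [a 1]. If [a 1 = n], then [th] is constant and a jump at 0 gives all coordinates
    the same label. *)
Lemma Theta2_jump n (th : n.-tuple R) : (0 < n)%N -> @Theta R n 2 th ->
  exists t : 'I_n, forall i j : 'I_n, (t <= i)%N = (t <= j)%N -> tnth th i = tnth th j.
Proof.
move=> n0 [a [mu [a0 a2 amono thE]]].
have a1n : (a 1 <= n)%N by rewrite -a2 amono.
have [a1|a1] := ltnP (a 1) n.
  exists (Ordinal a1) => i j /=.
  have [h1|h1] := leqP (a 1) i; have [h2|h2] := leqP (a 1) j => // _.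
    by rewrite (thE i 2) ?(thE j 2)//= a2 ltn_ord ltnS ?h1 ?h2.
  by rewrite (thE i 1) ?(thE j 1)//= a0.
exists (Ordinal n0) => i j _.
by rewrite (thE i 1) ?(thE j 1)//= a0 (leq_trans _ a1).
Qed.

Lemma minimax_upper_two n : (2 <= n)%N ->
  (minimax_risk sigma n 2 <=
    (16 * (448 * (sigma ^+ 2 * ln (ln (16 * n%:R)))))%:E)%E.
Proof.
move=> n2.
pose J := (trunc_log 2 n).+1.
have nJ : (n < 2 ^ J)%N by exact: trunc_log_ltn.
have Jn : (2 ^ J.-1 <= n)%N by rewrite trunc_logP//; lia.
apply: (@le_trans _ _ (4 * sigma ^+ 2 * (4 * (48 * ln J%:R + 192)))%:E).
  apply: (@minimax_le_oracle R sigma sigma0 n 2 1 _ (enum 'I_n)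
    (fun t i => nat_of_bool (t <= i)%N)).
  - by move=> t i j _ ij; lia.
  - by move=> t i _; exact: leq_b1.
  - by rewrite -size_eq0 size_enum_ord; lia.
  - move=> th /Theta2_jump[|t tE]; first by lia.
    exists t; rewrite ?mem_enum// => i j e; apply: tE.
    by move: e; case: (t <= i)%N; case: (t <= j)%N.
  - move=> th t0 _; have [H Hm HE] := @noise_energy_two n th J t0 nJ isT.
    by exists H.
have n0 : 0 < n%:R :> R by rewrite ltr0n; lia.
have l2 := ln2_le1 R.
have l20 := ln2_ge_half R.
have lnn : 5 / 2 <= ln (16 * n%:R) :> R.
  apply: (@le_trans _ _ (ln (2 ^+ 5))); first by rewrite lnX_natr//; lra.
  rewrite ler_ln ?posrE ?exprn_gt0 ?mulr_gt0//.
  have : 2 <= n%:R :> R by rewrite (ler_nat _ 2).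
  by rewrite !exprS expr0; lra.
(* [ln y >= 1 - 1 / y] with [y >= 5 / 2]. *)
have ll0 : 3 / 5 <= ln (ln (16 * n%:R)) :> R.
  have := @ln_le_subr1 R (ln (16 * n%:R))^-1; rewrite invr_gt0.
  have L0 : 0 < ln (16 * n%:R) :> R by lra.
  rewrite L0 => /(_ isT); rewrite lnV ?posrE// => h.
  have : (ln (16 * n%:R))^-1 <= (5 / 2)^-1 :> R by rewrite lef_pV2 ?posrE//; lra.
  by lra.
(* [2 ^ J <= 2 n] and [ln 2 >= 1 / 2] give [J <= 2 ln (16 n)]. *)
have lnJ : ln J%:R <= 1 + ln (ln (16 * n%:R)) :> R.
  have J0 : 0 < J%:R :> R by rewrite ltr0n.
  apply: (@le_trans _ _ (ln (2 * ln (16 * n%:R)))); last first.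
    by rewrite lnM ?posrE//; lra.
  rewrite ler_ln ?posrE ?mulr_gt0//; last by lra.
  have : J%:R * ln 2 <= ln (16 * n%:R) :> R.
    rewrite -lnX_natr// ler_ln ?posrE ?exprn_gt0 ?mulr_gt0//.
    rewrite exprS ler_pM ?exprn_ge0//; first by lra.
    by rewrite -natrX ler_nat.
  by nra.
rewrite lee_fin; have := sqr_ge0 sigma; move: (sigma ^+ 2) => s s0.
(* With [l] the iterated logarithm, [48 ln J + 192 <= 48 l + 240], and [240 <= 400 l] because
   [l >= 3 / 5]. *)
have : 0 <= s * (448 * ln (ln (16 * n%:R)) - (48 * ln J%:R + 192)).
  by rewrite mulr_ge0//; lra.
by lra.
Qed.

End two_pieces.

Theorem mainTheorem6 (R : realType) :
  exists c C : R, [/\ 0 < c, 0 < C &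
    forall (n k : nat) (sigma : R), (1 <= k <= n)%N -> 0 < sigma ->
      ((c * rate sigma n k)%:E <= minimax_risk sigma n k)%E /\
      (minimax_risk sigma n k <= (C * rate sigma n k)%:E)%E].
Proof.
(* The lower constant is the smallest of the three regimes, from [k >= 3]; the upper one is the
   largest, from [k = 2]. *)
exists (512^-1 * 64^-1), (16 * 448); split; [lra|lra|].
move=> n k sigma /andP[k1 kn] sigma0; rewrite /rate.
have s2 := sqr_ge0 sigma.
have [->|k1'] := eqVneq k 1%N.
  split.
    by apply: le_trans (minimax_lower_const sigma0 _ _); [rewrite lee_fin; lra|lia..].
  by apply: le_trans (minimax_upper_one sigma0 _) _; [lia|rewrite lee_fin; lra].
have [k2|k2] := eqVneq k 2%N.
  rewrite k2 in kn *; split.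
    apply: le_trans (minimax_lower_two sigma0 kn); rewrite lee_fin ler_wpM2r//; last by lra.
    rewrite mulr_ge0// ln_ge0// -natrM ln_ge1//; lia.
  by apply: le_trans (minimax_upper_two sigma0 kn) _; rewrite lee_fin mulrA.
have k0R : 0 < k%:R :> R by rewrite ltr0n.
have l0 : 0 <= ln (expR 1 * n%:R / k%:R) :> R.
  rewrite ln_ge0// ler_pdivlMr// mul1r.
  apply: (@le_trans _ _ n%:R); first by rewrite ler_nat.
  by rewrite ler_peMl// -expR0 ler_expR.
split.
  have := @minimax_lower_many R sigma sigma0 n k.
  by rewrite mulrA; apply; lia.
apply: le_trans (minimax_upper_many sigma0 _) _; first by lia.
rewrite lee_fin ler_wpM2r//; last by lra.
by rewrite mulr_ge0// mulr_ge0// ltW.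
Qed.
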